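(* Let $\mathbb{F}$ be a finite field of characteristic $p>2$, $r\ge2$, $t\ge 2$, let $V_1$ be a $t$-dimensional $\mathbb{F}$-space and $V=V_1^{\otimes r}=V_1\otimes\cdots\otimes V_r$ (each $V_i$ a copy of $V_1$), and let $H=\mathrm{GL}(V_1)\wr\mathrm{S}_r\le\mathrm{GL}(V)$ be the stabiliser of this tensor decomposition (base group acting factorwise, $\mathrm{S}_r$ permuting the factors). (i) If $r>2$, then $L^2V$ is a reducible $H$-module, and the minimum dimension of a non-zero quotient of $L^2V$ by an $H$-submodule is $\binom t2^r$ if $r$ is odd and $r\binom t2^{r-1}\binom{t+1}2$ if $r$ is even. (ii) If $p>3$ and $r=2$, then $L^2V$ is an irreducible $H$-module and $L^3V$ is a reducible $H$-module; the minimum dimension of a non-zero quotient of $L^3V$ by an $H$-submodule is $4$ if $t=2$, and $(t+1)t^2(t-1)^2(t-2)/9$ if $t>2$.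
   Context: $L^nV$ is the $n$th Lie power of $V$: with $[u,v]=u\otimes v-v\otimes u$ in the tensor algebra of $V$, $L(V)$ is the closure of $V$ under the bracket and $L^nV=V^{\otimes n}\cap L(V)$, with diagonal action of $\mathrm{GL}(V)$ (hence of $H$). $L^2V=A^2V$. *)

(* Defs.v *)
From HB Require Import structures.
From mathcomp Require Import all_boot all_order all_algebra all_fingroup.
Import GRing.Theory.
Local Open Scope ring_scope.

(* V1 = F^t with standard basis indexed by 'I_t.
   V = V1^{(x) r} has basis e_j, j : Idx t r = {ffun 'I_r -> 'I_t}
   (e_j = e_{j 0} (x) ... (x) e_{j (r-1)}).
   V^{(x) n} has basis indexed by Tidx t r n = {ffun 'I_n -> Idx t r}. *)
Definition Idx (t r : nat) := {ffun 'I_r -> 'I_t}.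
Definition Tidx (t r n : nat) := {ffun 'I_n -> Idx t r}.
Definition tdim (t r n : nat) : nat := #|{: Tidx t r n}|.

Definition tval (t r n : nat) (j : 'I_(tdim t r n)) : Tidx t r n :=
  @enum_val (Tidx t r n) _ j.

Definition tcoord (F : finFieldType) (t r n : nat) (x : 'rV[F]_(tdim t r n))
  (a : Tidx t r n) : F := x 0 (enum_rank a).

Definition tmk (F : finFieldType) (t r n : nat) (f : Tidx t r n -> F)
  : 'rV[F]_(tdim t r n) := \row_j f (tval t r n j).

Definition tappend (F : finFieldType) (t r n : nat)
  (x : 'rV[F]_(tdim t r n)) (v : 'rV[F]_(tdim t r 1)) : 'rV[F]_(tdim t r n.+1) :=
  tmk F t r n.+1 (fun c =>
    tcoord F t r n x [ffun i : 'I_n => c (widen_ord (leqnSn n) i)] *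
    tcoord F t r 1 v [ffun _ : 'I_1 => c ord_max]).

Definition tprepend (F : finFieldType) (t r n : nat)
  (v : 'rV[F]_(tdim t r 1)) (x : 'rV[F]_(tdim t r n)) : 'rV[F]_(tdim t r n.+1) :=
  tmk F t r n.+1 (fun c =>
    tcoord F t r 1 v [ffun _ : 'I_1 => c ord0] *
    tcoord F t r n x [ffun i : 'I_n => c (lift ord0 i)]).

Definition lbr (F : finFieldType) (t r n : nat)
  (x : 'rV[F]_(tdim t r n)) (v : 'rV[F]_(tdim t r 1)) : 'rV[F]_(tdim t r n.+1) :=
  tappend F t r n x v - tprepend F t r n v x.

(* Lie powers: the row space of LiePow F t r n is L^n V
   (L^0 = 0, L^1 = V, L^{m+1} = span { [x, v] : x in L^m, v in V }, m >= 1). *)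
Fixpoint LiePow (F : finFieldType) (t r n : nat) : 'M[F]_(tdim t r n) :=
  match n return 'M[F]_(tdim t r n) with
  | 0 => 0
  | m.+1 =>
      if m is 0 then 1%:M else
      (\sum_(x : 'rV[F]_(tdim t r m) | (x <= LiePow F t r m)%MS)
         \sum_(v : 'rV[F]_(tdim t r 1)) <<lbr F t r m x v>>)%MS
  end.

(* Matrix (row-vector convention: x |-> x *m M) of the element h = (g, s) of
   H = GL(V1) wr S_r acting diagonally on V^{(x) n}.  On V,
   h e_j = (x)_k g_k e_{j (s^-1 k)}  (s permutes the tensor factors, then g_k
   acts on factor k; g_k acts on column vectors: g e_b = sum_a g a b e_a). *)
Definition Hmat (F : finFieldType) (t r n : nat) (g : 'I_r -> 'M[F]_t)
  (s : 'S_r) : 'M[F]_(tdim t r n) :=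
  \matrix_(i, j) \prod_(m < n) \prod_(k < r)
      g k (tval t r n j m k) (tval t r n i m ((s^-1)%g k)).

Definition Hsubmod (F : finFieldType) (t r n : nat) (W : 'M[F]_(tdim t r n)) : Prop :=
  (W <= LiePow F t r n)%MS /\
  forall (g : 'I_r -> 'M[F]_t) (s : 'S_r),
    (forall k, g k \in unitmx) -> (W *m Hmat F t r n g s <= W)%MS.

Definition Hreducible (F : finFieldType) (t r n : nat) : Prop :=
  exists W, Hsubmod F t r n W /\
    (0 < \rank W)%N /\ (\rank W < \rank (LiePow F t r n))%N.

Definition Hirreducible (F : finFieldType) (t r n : nat) : Prop :=
  (0 < \rank (LiePow F t r n))%N /\
  forall W, Hsubmod F t r n W ->
    \rank W = 0%N \/ \rank W = \rank (LiePow F t r n).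

Definition min_quot_dim (F : finFieldType) (t r n d : nat) : Prop :=
  (exists W, Hsubmod F t r n W /\ (\rank W < \rank (LiePow F t r n))%N /\
      (\rank (LiePow F t r n) - \rank W)%N = d) /\
  (forall W, Hsubmod F t r n W -> (\rank W < \rank (LiePow F t r n))%N ->
      (d <= \rank (LiePow F t r n) - \rank W)%N).

(* Main.v *)
Require Import Defs.
From HB Require Import structures.
From mathcomp Require Import all_boot all_order all_algebra all_fingroup all_field.
From mathcomp Require Import ring zify.

(** Write T = V^{(x) n} as the tensor product over k of the spaces V_k^{(x) n}.
    The product of r copies of S_n permutes the n places inside each of these
    spaces independently, and commutes with the base group GL(V_1)^r.  For
    n < |F| the base group spans the whole centraliser of these place
    permutations: the n-th tensor power of a singular matrix is a combination of
    tensor powers of units (interpolate along a pencil X + c Y that is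
    invertible for all c <> 0), and polarisation yields all symmetrised
    elementary tensors.  As n! is invertible in F, the submodules of T for the
    base group are therefore governed by idempotents of F[S_n]^{(x) r}.

    For n = 2 the Lie power is the image of (1 - swap)/2, the sum of the products
    of alternating and symmetric squares with an odd number of alternating
    factors; S_r permutes those with a given number of alternating factors
    transitively.  For n = 3 and r = 2 it is the image of the diagonal copy of
    a primitive idempotent of the 2-dimensional block of F[S_3], and it splits
    into five simple pieces: (21) (x) (3), (21) (x) (111), their mirror images,
    and (21) (x) (21).  Counting dimensions orbit by orbit gives the theorem. *)

Set Implicit Arguments.
Unset Strict Implicit.
Unset Printing Implicit Defensive.
Import GRing.Theory.

(** * Finite fields, polarisation and pencils *)

(** The pieces lie in different blocks of F[S_n]^{(x) r}, so there are no diagonal submodules: an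
    H-submodule is the sum of the pieces it contains, and the smallest quotient is the smallest
    non-zero S_r-orbit of pieces. The field may be as small as F_3 when n = 2. The interpolation
    over c must therefore allow n = |F| - 1, where a term Y^{(x) n} survives; this is why Y itself
    has to be a unit. For n = 2 an alternating factor is smaller than a symmetric one. If r is odd,
    the wholly alternating piece is the minimum; if r is even, it has an even number of alternating
    factors, is absent from L^2V, and one symmetric factor must be allowed. For n = 3 let m =
    t(t^2-1)/3 be the dimension of the hook (21). The orbits have dimensions m^2, 2m C(t+2,3) and 2m
    C(t,3). The last is the smallest, unless t = 2, where it vanishes and m^2 = 4 takes its
    place. *)

Section FiniteFieldSums.
Variable F : finFieldType.
Local Open Scope ring_scope.

Lemma natr_card_finField : #|F|%:R = 0 :> F.
Proof.
have h : \sum_(c : F) c = \sum_(c : F) (c + 1).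
  by rewrite (reindex_inj (addIr 1)).
move: h; rewrite big_split /= sumr_const => /eqP.
by rewrite -[X in X == _]addr0 (inj_eq (addrI _)) eq_sym => /eqP.
Qed.

(** Scaling the summation variable by a non-zero [a] multiplies the sum by [a ^+ k], so the sum
    vanishes as soon as some [a ^+ k] differs from 1. For [k = 0] the sum is |F| = 0 in F, as 0^0 =
    1. *)
Lemma sum_expr_finField k : (k < #|F|)%N ->
  \sum_(c : F) c ^+ k = - (k == #|F|.-1)%:R.
Proof.
move=> kq; have q1 : (1 < #|F|)%N := finNzRing_gt1 F.
have nz (a : F) : a != 0 -> a ^+ #|F|.-1 = 1.
  move=> a0; apply: (mulfI a0); rewrite mulr1 -exprS prednK ?expf_card //.
  exact: ltnW.
have [->|kn] := eqVneq k #|F|.-1.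
  rewrite (bigD1 0) //= expr0n eqn0Ngt -subn1 subn_gt0 q1 add0r subn1.
  have -> : \sum_(i : F | i != 0) i ^+ #|F|.-1 = \sum_(i : F | i != 0) 1.
    by apply: eq_bigr => i /nz.
  have := natr_card_finField; rewrite -sumr_const (bigD1 0) //= => /eqP.
  by rewrite addrC addr_eq0 => /eqP.
rewrite oppr0; case: k kq kn => [|k] kq kn.
  by under eq_bigr do rewrite expr0; rewrite sumr_const natr_card_finField.
(* Otherwise all |F| - 1 non-zero elements would be roots of X^(k+1) - 1, whose degree is less than
   |F| - 1. *)
have [a a0 ak] : exists2 a : F, a != 0 & a ^+ k.+1 != 1.
  apply/exists_inP; apply: contraT; rewrite negb_exists_in => /forall_inP h.
  have := @max_unity_roots F k.+1 (enum (predC1 (0 : F))) isT.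
  rewrite enum_uniq -cardE cardC1 => /(_ _ isT) => le.
  suff : (#|F|.-1 <= k.+1)%N by lia.
  apply: le; apply/allP => b; rewrite mem_enum => /h.
  by rewrite negbK => bk; rewrite unity_rootE.
have ak1 : a ^+ k.+1 - 1 != 0 by rewrite subr_eq0.
apply/eqP; rewrite -(mulrI_eq0 _ (mulfI ak1)).
rewrite mulrBl mul1r mulr_sumr subr_eq0; apply/eqP.
rewrite [RHS](reindex_inj (mulfI a0)) /=.
by apply: eq_bigr => i _; rewrite exprMn.
Qed.

(** Only the power sum of exponent |F| - 1 is non-zero. This is the interpolation used on pencils of
    matrices. *)
Lemma sum_horner_finField (p : {poly F}) : (size p <= #|F|)%N ->
  \sum_(c : F) p.[c] = - p`_(#|F|.-1).
Proof.
move=> sp.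
under eq_bigr => c _ do rewrite (horner_coef_wide c sp).
rewrite exchange_big /=.
under eq_bigr => k _ do rewrite -mulr_sumr sum_expr_finField //.
have q0 : (#|F|.-1 < #|F|)%N by rewrite prednK // ltnW // finNzRing_gt1.
rewrite (bigD1 (Ordinal q0)) //= eqxx mulrN mulr1 big1 ?addr0 // => k kq.
by rewrite (_ : (_ == _) = false) ?oppr0 ?mulr0 //; apply/negbTE.
Qed.
End FiniteFieldSums.

Section LinearProducts.
Variable R : comNzRingType.
Local Open Scope ring_scope.

(** Such products are the entries of the n-th tensor power of a pencil X + c Y, as polynomials in c;
    the top coefficient comes from Y alone. *)
Lemma size_coef_prod_linear n (a b : 'I_n -> R) :
  let P := \prod_(m < n) ((a m)%:P + b m *: 'X) in
  (size P <= n.+1)%N /\ P`_n = \prod_(m < n) b m.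
Proof.
elim: n a b => [|n IHn] a b /=.
  by rewrite !big_ord0 size_poly1 coefC.
rewrite !big_ord_recr /=.
have [] := IHn (fun i => a (widen_ord (leqnSn n) i)) (fun i => b (widen_ord (leqnSn n) i)).
set P := \prod_(m < n) _ => sP cP; split.
  apply: leq_trans (size_polyMleq _ _) _.
  suff : (size ((a ord_max)%:P + b ord_max *: 'X)%R <= 2)%N by lia.
  apply: leq_trans (size_polyD _ _) _; rewrite geq_max (leq_trans (size_polyC_leq1 _)) //=.
  by rewrite (leq_trans (size_scale_leq _ _)) // size_polyX.
rewrite mulrDr coefD coefMC -scalerAr coefZ coefMX /= cP.
by rewrite nth_default // mul0r add0r mulrC.
Qed.

(** Ryser's formula for the permanent, which is polarisation read entrywise. After expanding the
    products over functions f, the signs of the sets S containing the image of f cancel unless f is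
    a bijection. *)
Lemma ryser n (x : 'I_n -> 'I_n -> R) :
  \sum_(s : 'S_n) \prod_m x m (s m) =
  \sum_(S : {set 'I_n}) (-1) ^+ #|~: S| * \prod_m \sum_(l in S) x m l.
Proof.
have incl (f : {ffun 'I_n -> 'I_n}) :
    \sum_(S : {set 'I_n} | f \in ffun_on (mem S)) (-1) ^+ #|~: S| = (injectiveb f)%:R :> R.
  (* Each factor is 1 - [l not in the image of f]. Expanding the product, S collects the indices
     where the term 1 is taken. *)
  transitivity (\prod_(l < n) ((l \in codom f)%:R : R)); last first.
    case: (boolP (injectiveb f)) => [/injectiveP fi|fN].
      rewrite big1 // => l _.
      by rewrite (inj_card_onto fi).
    have : ~~ [forall l, l \in codom f].
      apply: contra fN => /forallP h; apply/card_uniqP.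
      rewrite size_map -cardE; apply: eq_card => l; rewrite [RHS]inE; exact: h.
    by rewrite negb_forall => /existsP[l /negbTE lf]; rewrite (bigD1 l) //= lf mul0r.
  under [RHS]eq_bigr => l _.
    rewrite (_ : _%:R = 1 + - (l \notin codom f)%:R); first over.
    by case: (l \in _); rewrite /= ?subr0 ?subrr.
  rewrite (bigA_distr 1 +%R) big_mkcond /=; apply: eq_bigr => S _.
  rewrite (bigID (mem S)) /= big1 ?mul1r; last by move=> l ->.
  case: ifPn => [/ffun_onP fS|].
    rewrite -prodr_const; apply: eq_big => l; first by rewrite inE.
    rewrite inE => lS; rewrite (negbTE lS).
    have -> // : l \notin codom f by apply: contra lS => /codomP[m ->]; apply: fS.
  move=> fN; have /existsP[m fm] : [exists m, f m \notin S].
    by rewrite -negb_forall; apply: contra fN => /forallP fS; apply/ffun_onP.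
  by rewrite (bigD1 (f m)) //= (negbTE fm) codom_f /= oppr0 mul0r.
under [RHS]eq_bigr => S _ do rewrite bigA_distr_big mulr_sumr.
rewrite (exchange_big_dep xpredT) //=.
under [RHS]eq_bigr => f _ do rewrite -mulr_suml incl.
rewrite [RHS](bigID (fun f : {ffun 'I_n -> 'I_n} => injectiveb f)) /=.
rewrite [X in _ = _ + X]big1 ?addr0; last by move=> f /negbTE ->; rewrite mul0r.
rewrite [RHS](reindex (fun s : 'S_n => pval s)) /=; last first.
  exists (insubd (1%g : 'S_n)) => [s _|f fi]; first by rewrite -[pval s]/(val s) valKd.
  by rewrite -[pval _]/(val _) insubdK.
apply: eq_big => [s|s _]; first by rewrite (valP s).
by rewrite (valP s) mul1r; apply: eq_bigr => m _; rewrite pvalE.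
Qed.
End LinearProducts.

Section Pencil.
Variables (F : fieldType) (t : nat).
Local Open Scope ring_scope.

(* After multiplying by units, [X] becomes a truncated cyclic shift, which is
   nilpotent. *)
Lemma singular_pencil (X : 'M[F]_t) : X \notin unitmx ->
  exists2 Y, Y \in unitmx & forall c, c != 0 -> X + c *: Y \in unitmx.
Proof.
move=> Xs.
have rX : (\rank X < t)%N.
  by rewrite ltn_neqAle rank_leq_row andbT; apply: contra Xs; rewrite -row_free_unit.
pose s : 'S_t := perm (@ordS_inj t).
pose S : 'M[F]_t := perm_mx s.
have uS : S \in unitmx by rewrite unitmx_perm.
pose N : 'M[F]_t := pid_mx (\rank X) *m S.
exists (col_ebase X *m invmx S *m row_ebase X).
  by rewrite !unitmx_mul col_ebase_unit row_ebase_unit unitmx_inv uS.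
move=> c c0.
have -> : X + c *: (col_ebase X *m invmx S *m row_ebase X) =
          col_ebase X *m (N + c%:M) *m (invmx S *m row_ebase X).
  rewrite mulmxDr !mulmxDl -{1}(mulmx_ebase X) /N !mulmxA.
  by rewrite -(mulmxA _ S) mulmxV // mulmx1 mul_mx_scalar -!scalemxAl.
rewrite !unitmx_mul col_ebase_unit row_ebase_unit unitmx_inv uS /= andbT.
have NE i j : N i j = ((s i == j) && (i < \rank X)%N)%:R.
  have -> : N = col_perm (s^-1)%g (pid_mx (\rank X)) by rewrite col_permE invgK.
  by rewrite !mxE (canF_eq (permK s)).
(* Singularity enters here: the rank is less than t, so the shift does not wrap around on the rows
   that survive, and [N + c%:M] is triangular with diagonal c. *)
have sE (i : 'I_t) : (i < \rank X)%N -> val (s i) = i.+1.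
  by move=> ir; rewrite permE /= modn_small // (leq_ltn_trans ir).
have NT : is_trig_mx (N + c%:M)^T.
  apply/is_trig_mxP => i j ij; rewrite [LHS]mxE [LHS]mxE NE mxE.
  rewrite (_ : (j == i) = false) ?mulr0n ?addr0; last by apply/eqP => ji; rewrite ji ltnn in ij.
  case: eqP => //= e; case: ltnP => //= /sE; rewrite e /= => ji.
  by move: ij; rewrite ji ltnNge leqnSn.
rewrite unitmxE unitfE -det_tr det_trig //; apply/prodf_neq0 => i _.
rewrite [X in X != _]mxE [X in X != _]mxE NE mxE eqxx mulr1n.
rewrite (_ : _ && _ = false) ?add0r //; apply/negP => /andP[/eqP e /sE].
by rewrite e => /n_Sn.
Qed.
End Pencil.

(** * Place permutations *)

Definition place_act (t n : nat) (x : n.-tuple 'I_t) (s : 'S_n) : n.-tuple 'I_t :=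
  [tuple tnth x (s m) | m < n].

Lemma place_act1 t n (x : n.-tuple 'I_t) : place_act x 1%g = x.
Proof. by apply: eq_from_tnth => m; rewrite tnth_mktuple perm1. Qed.

Lemma place_actM t n (x : n.-tuple 'I_t) s u :
  place_act (place_act x s) u = place_act x (u * s)%g.
Proof. by apply: eq_from_tnth => m; rewrite !tnth_mktuple permM. Qed.

Lemma place_actK t n (x : n.-tuple 'I_t) s : place_act (place_act x s) s^-1 = x.
Proof. by rewrite place_actM mulVg place_act1. Qed.

Lemma place_actKV t n (x : n.-tuple 'I_t) s : place_act (place_act x s^-1) s = x.
Proof. by rewrite place_actM mulgV place_act1. Qed.

(* The dimension of the n-th tensor power of F^t, with basis indexed by
   [n.-tuple 'I_t]. *)
Definition pdim (t n : nat) : nat := #|{: n.-tuple 'I_t}|.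

Definition ptup (t n : nat) (i : 'I_(pdim t n)) : n.-tuple 'I_t :=
  @enum_val {: n.-tuple 'I_t} _ i.

Definition prank (t n : nat) (x : n.-tuple 'I_t) : 'I_(pdim t n) := enum_rank x.

Lemma prankK t n : cancel (@prank t n) (@ptup t n).
Proof. exact: enum_rankK. Qed.

Lemma ptupK t n : cancel (@ptup t n) (@prank t n).
Proof. exact: enum_valK. Qed.

Section PlacePermutations.
Variables (F : finFieldType) (t n : nat).
Local Open Scope ring_scope.
Local Notation N := (pdim t n).

Definition place_mx (s : 'S_n) : 'M[F]_N :=
  \matrix_(i, j) (ptup j == place_act (ptup i) s)%:R.

Lemma mul_place_mx s (A : 'M[F]_N) i j :
  (place_mx s *m A) i j = A (prank (place_act (ptup i) s)) j.
Proof.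
rewrite mxE (bigD1 (prank (place_act (ptup i) s))) //= mxE prankK eqxx mul1r.
rewrite big1 ?addr0 // => k ki; rewrite mxE.
by rewrite -(inj_eq (can_inj (@ptupK t n))) prankK in ki; rewrite (negbTE ki) mul0r.
Qed.

Lemma mul_mx_place s (A : 'M[F]_N) i j :
  (A *m place_mx s) i j = A i (prank (place_act (ptup j) s^-1)).
Proof.
rewrite mxE (bigD1 (prank (place_act (ptup j) s^-1))) //= mxE prankK place_actKV eqxx mulr1.
rewrite big1 ?addr0 // => k kj; rewrite mxE; case: eqP => [e|_]; last by rewrite mulr0.
by rewrite e place_actK ptupK eqxx in kj.
Qed.

Lemma place_mx1 : place_mx 1 = 1%:M.
Proof.
apply/matrixP => i j; rewrite !mxE place_act1 (inj_eq (can_inj (@ptupK t n))).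
by rewrite eq_sym.
Qed.

(** The order is reversed because [u * s] applies [u] first. *)
Lemma place_mxM s u : place_mx s *m place_mx u = place_mx (u * s)%g.
Proof.
by apply/matrixP => i j; rewrite mul_place_mx !mxE prankK place_actM.
Qed.

Lemma place_mxK s : place_mx s^-1 *m place_mx s = 1%:M.
Proof. by rewrite place_mxM mulgV place_mx1. Qed.

(* The n-th tensor power of [g], transposed because [Hmat] acts on rows. *)
Definition tens_pow (g : 'M[F]_t) : 'M[F]_N :=
  \matrix_(i, j) \prod_(m < n) g (tnth (ptup j) m) (tnth (ptup i) m).

Lemma tens_pow_place g s : place_mx s *m tens_pow g = tens_pow g *m place_mx s.
Proof.
apply/matrixP => i j; rewrite mul_place_mx mul_mx_place !mxE.
rewrite [RHS](reindex_inj (@perm_inj _ s)); apply: eq_bigr => m _.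
by rewrite !prankK !tnth_mktuple permK.
Qed.

Lemma tens_pow1 : tens_pow 1%:M = 1%:M.
Proof.
apply/matrixP => i j; rewrite !mxE.
have [->|ij] := eqVneq i j; first by rewrite big1 // => m _; rewrite mxE eqxx.
have : [exists m, tnth (ptup j) m != tnth (ptup i) m].
  rewrite -negb_forall; apply: contra ij => /forallP e.
  rewrite -(inj_eq (can_inj (@ptupK t n))) eq_sym; apply/eqP/eq_from_tnth => m.
  by apply/eqP.
by case/existsP => m mij; rewrite (bigD1 m) //= mxE (negbTE mij) mul0r.
Qed.

Definition pow_span (Z : 'M[F]_N) : Prop :=
  exists c : 'M[F]_t -> F, Z = \sum_(g | g \in unitmx) c g *: tens_pow g.

Lemma pow_span_unit g : g \in unitmx -> pow_span (tens_pow g).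
Proof.
move=> gu; exists (fun h => (h == g)%:R).
rewrite (bigD1 g) //= eqxx scale1r big1 ?addr0 // => h /andP[_ /negbTE->].
by rewrite scale0r.
Qed.

Lemma pow_span_sum (I : finType) (P : pred I) (a : I -> F) (Z : I -> 'M[F]_N) :
  (forall i, P i -> pow_span (Z i)) -> pow_span (\sum_(i | P i) a i *: Z i).
Proof.
move=> PZ; elim/big_rec: _ => [|i Y Pi [c ->]].
  by exists (fun=> 0); rewrite big1 // => g _; rewrite scale0r.
have [d ->] := PZ i Pi; exists (fun g => a i * d g + c g).
rewrite scaler_sumr -big_split /=; apply: eq_bigr => g _.
by rewrite scalerDl scalerA.
Qed.

(** Summed over all c in F, the tensor powers of g + c Y give the coefficient of c^(|F|-1) up to
    sign: zero, or [tens_pow Y] when n = |F| - 1. The term c = 0 is the wanted one, and all others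
    come from units. *)
Lemma tens_pow_span g : (n < #|F|)%N -> pow_span (tens_pow g).
Proof.
move=> nq; have [|gs] := boolP (g \in unitmx); first exact: pow_span_unit.
have [Y uY gY] := singular_pencil gs.
have key : \sum_(c : F) tens_pow (g + c *: Y) = - (n == #|F|.-1)%:R *: tens_pow Y.
  apply/matrixP => i j; rewrite summxE !mxE.
  pose a m := g (tnth (ptup j) m) (tnth (ptup i) m).
  pose b m := Y (tnth (ptup j) m) (tnth (ptup i) m).
  have [sP cP] := size_coef_prod_linear a b.
  transitivity (\sum_(c : F) (\prod_(m < n) ((a m)%:P + b m *: 'X)).[c]).
    apply: eq_bigr => c _; rewrite mxE horner_prod; apply: eq_bigr => m _.
    by rewrite !mxE hornerD hornerC hornerZ hornerX mulrC.
  rewrite sum_horner_finField ?(leq_trans sP) //; have [e|ne] := eqVneq n _.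
    by rewrite -e cP mulN1r.
  rewrite nth_default ?oppr0 ?mul0r // (leq_trans sP) //.
  by move: nq ne; case: #|F| => // q /=; rewrite ltnS leq_eqVlt => /orP[->|].
move: key; rewrite (bigD1 0) //= scale0r addr0 => /eqP; rewrite eq_sym -subr_eq => /eqP <-.
(* [None] indexes the contribution of Y, so that everything becomes a single sum over a finite
   type. *)
pose h (o : option F) : 'M[F]_N :=
  if o is Some c then tens_pow (g + c *: Y) else tens_pow Y.
pose d (o : option F) : F := if o is Some c then - 1 else - (n == #|F|.-1)%:R.
have -> : - (n == #|F|.-1)%:R *: tens_pow Y - \sum_(i | i != 0) tens_pow (g + i *: Y) =
          \sum_(o | o != Some 0) d o *: h o.
  rewrite (bigD1 None) //=; congr (_ + _).
  rewrite -sumrN (reindex_onto (fun c : F => Some c) (odflt 0)) /=; last by case.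
  apply: eq_big => [c|c _]; first by rewrite eqxx !andbT.
  by rewrite scaleN1r.
by apply: pow_span_sum => -[c|] o0; apply: pow_span_unit => //; apply: gY.
Qed.

(** The symmetrised elementary matrix is the polarisation of n elementary matrices of size t, one
    for each place. [ryser] writes it as a signed sum of tensor powers, of singular matrices in
    general, which [tens_pow_span] then handles. *)
Lemma sym_delta_span (x y : 'I_N) : (n < #|F|)%N ->
  pow_span (\sum_(s : 'S_n) place_mx s^-1 *m delta_mx x y *m place_mx s).
Proof.
move=> nq.
(* The roles of x and y are exchanged because [tens_pow] is transposed. *)
pose M l : 'M[F]_t := delta_mx (tnth (ptup y) l) (tnth (ptup x) l).
have -> : \sum_(s : 'S_n) place_mx s^-1 *m delta_mx x y *m place_mx s =
          \sum_(S : {set 'I_n}) (-1) ^+ #|~: S| *: tens_pow (\sum_(l in S) M l).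
  apply/matrixP => i j; rewrite !summxE.
  under [RHS]eq_bigr => S _.
    rewrite mxE mxE; under eq_bigr => m _ do rewrite summxE.
    over.
  rewrite -ryser; apply: eq_bigr => s _; rewrite mul_mx_place mul_place_mx !mxE.
  rewrite !(can2_eq (@prankK t n) (@ptupK t n)).
  have actE (z z' : n.-tuple 'I_t) :
      (place_act z s^-1 == z') = [forall m, tnth z m == tnth z' (s m)].
    apply/eqP/forallP => [<- m|e]; first by rewrite tnth_mktuple permK.
    by apply: eq_from_tnth => m; rewrite tnth_mktuple (eqP (e _)) permKV.
  rewrite !actE.
  have [/existsP[m mN]|] := boolP [exists m, ~~ ((tnth (ptup j) m == tnth (ptup y) (s m)) &&
                               (tnth (ptup i) m == tnth (ptup x) (s m)))].
    rewrite (bigD1 m) //= mxE (negbTE mN) mul0r.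
    case: forallP => [/(_ m) xm|//]; case: forallP => [/(_ m) ym|//].
    by rewrite xm ym in mN.
  rewrite negb_exists => /forallP e; rewrite big1 => [|m _]; last first.
    by rewrite mxE; move: (e m); rewrite negbK => ->.
  rewrite (_ : _ && _) //; apply/andP; split; apply/forallP => m;
    by move: (e m); rewrite negbK => /andP[].
by apply: pow_span_sum => S _; apply: tens_pow_span.
Qed.

End PlacePermutations.

(** * Regrouping the tensor factors *)

Section RankLemmas.
Variable F : fieldType.
Local Open Scope ring_scope.

(** Factoring through the rows in R bounds the rank above, and the invertible diagonal minor on R
    bounds it below. For (anti)symmetrisers, R consists of the sorted tuples; [a i] may vanish, as
    it does for tuples with a repetition. *)
Lemma rank_of_reps N (M : 'M[F]_N) (R : {set 'I_N}) (rep : 'I_N -> 'I_N)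
    (a d : 'I_N -> F) :
  (forall i j, M i j = a i * M (rep i) j) ->
  (forall i, a i != 0 -> rep i \in R) ->
  (forall i j, i \in R -> j \in R -> M i j = d i *+ (i == j)) ->
  (forall i, i \in R -> d i != 0) ->
  \rank M = #|R|.
Proof.
move=> Mrep repR Md d0; apply/eqP; rewrite eqn_leq; apply/andP; split.
  pose A : 'M[F]_(N, #|R|) := \matrix_(i, k) (a i *+ (rep i == enum_val k)).
  pose B : 'M[F]_(#|R|, N) := rowsub enum_val M.
  have -> : M = A *m B.
    apply/matrixP => i j; rewrite Mrep mxE.
    have [ai|ai] := eqVneq (a i) 0.
      rewrite ai mul0r big1 // => k _; rewrite !mxE ai mul0rn mul0r //.
    have iR := repR i ai.
    rewrite (bigD1 (enum_rank_in iR (rep i))) //= !mxE enum_rankK_in // eqxx mulr1n.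
    rewrite big1 ?addr0 // => k ki; rewrite !mxE; case: eqP => [e|_]; last by rewrite mul0r.
    by case/eqP: ki; rewrite -(enum_valK_in iR k) -e.
  exact: leq_trans (mxrankM_maxl _ _) (rank_leq_col _).
pose C : 'M[F]_#|R| := mxsub enum_val enum_val M.
have Cd : C = diag_mx (\row_k d (enum_val k)).
  apply/matrixP => i j; rewrite !mxE Md ?enum_valP //.
  by rewrite (inj_eq enum_val_inj).
have uC : C \in unitmx.
  rewrite unitmxE unitfE Cd det_diag; apply/prodf_neq0 => k _.
  by rewrite mxE d0 ?enum_valP.
rewrite -{1}(mxrank_unit uC).
have -> : C = rowsub enum_val 1%:M *m M *m colsub enum_val 1%:M.
  by rewrite mul_rowsub_mx mul1mx mulmx_colsub mulmx1; apply/matrixP => i j; rewrite !mxE.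
exact: leq_trans (mxrankM_maxl _ _) (mxrankM_maxr _ _).
Qed.

Lemma rank_diag01 N (P : pred 'I_N) :
  \rank (diag_mx (\row_i (P i)%:R) : 'M[F]_N) = #|[set i | P i]|.
Proof.
apply: (@rank_of_reps _ _ _ id (fun i => (P i)%:R) (fun=> 1)) => [i j|i|i j|i _].
- by rewrite !mxE; case: (P i); rewrite ?mul1r ?mul0r ?mul0rn.
- by rewrite inE; case: (P i); rewrite ?eqxx.
- by rewrite !inE !mxE => -> _.
- exact: oner_neq0.
Qed.
End RankLemmas.

Section Tensors.
Variables (F : finFieldType) (t r n : nat).
Local Open Scope ring_scope.
Local Notation N := (pdim t n).
Local Notation D := (tdim t r n).

(* The k-th tensor factor of a basis vector of V^{(x) n}, where V^{(x) n} is
   regrouped as (V_1^{(x) n}) (x) ... (x) (V_r^{(x) n}). *)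
Definition slice (i : 'I_D) (k : 'I_r) : 'I_N :=
  prank [tuple Defs.tval t r n i m k | m < n].

Definition unslice (f : 'I_r -> 'I_N) : 'I_D :=
  enum_rank ([ffun m => [ffun k => tnth (ptup (f k)) m]] : Tidx t r n).

Lemma sliceK i : unslice (slice i) = i.
Proof.
rewrite /unslice -[RHS]enum_valK; congr enum_rank.
by apply/ffunP => m; apply/ffunP => k; rewrite !ffunE prankK tnth_mktuple.
Qed.

Lemma unsliceK f k : slice (unslice f) k = f k.
Proof.
rewrite /slice -[RHS]ptupK; congr prank; apply: eq_from_tnth => m.
by rewrite tnth_mktuple /Defs.tval enum_rankK !ffunE.
Qed.

Lemma eq_slice i j : (forall k, slice i k = slice j k) -> i = j.
Proof.
move=> e; rewrite -(sliceK i) -(sliceK j) /unslice; congr enum_rank.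
by apply/ffunP => m; apply/ffunP => k; rewrite !ffunE e.
Qed.

Lemma tval_slice i m k : Defs.tval t r n i m k = tnth (ptup (slice i k)) m.
Proof. by rewrite prankK tnth_mktuple. Qed.

Lemma big_slice (R : Type) (idx : R) (op : Monoid.com_law idx)
    (G : {ffun 'I_r -> 'I_N} -> R) :
  \big[op/idx]_i G [ffun k => slice i k] = \big[op/idx]_f G f.
Proof.
rewrite [RHS](reindex (fun i => [ffun k => slice i k])) //=.
exists (fun f : {ffun 'I_r -> 'I_N} => unslice f) => [i _|f _].
  by apply: eq_slice => k; rewrite unsliceK ffunE.
by apply/ffunP => k; rewrite ffunE unsliceK.
Qed.

Definition tens (Z : 'I_r -> 'M[F]_N) : 'M[F]_D :=
  \matrix_(i, j) \prod_k Z k (slice i k) (slice j k).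

Lemma eq_tens Z Z' : (forall k, Z k = Z' k) -> tens Z = tens Z'.
Proof.
by move=> e; apply/matrixP => i j; rewrite !mxE; apply: eq_bigr => k _; rewrite e.
Qed.

Lemma tensM Z Z' : tens Z *m tens Z' = tens (fun k => Z k *m Z' k).
Proof.
apply/matrixP => i j; rewrite !mxE.
under [RHS]eq_bigr => k _ do rewrite mxE.
rewrite bigA_distr_bigA -big_slice; apply: eq_bigr => l _.
by rewrite !mxE -big_split; apply: eq_bigr => k _; rewrite ffunE.
Qed.

Lemma tens_diag (d : 'I_r -> 'rV[F]_N) :
  tens (fun k => diag_mx (d k)) = diag_mx (\row_i \prod_k d k 0 (slice i k)).
Proof.
apply/matrixP => i j; rewrite !mxE; have [->|ij] := eqVneq i j.
  by rewrite mulr1n; apply: eq_bigr => k _; rewrite mxE eqxx.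
rewrite mulr0n; have /existsP[k ijk] : [exists k, slice i k != slice j k].
  rewrite -negb_forall; apply: contra ij => /forallP e.
  by apply/eqP/eq_slice => k; apply/eqP.
by rewrite (bigD1 k) //= mxE (negbTE ijk) mulr0n mul0r.
Qed.

Lemma tens1 : tens (fun=> 1%:M) = 1%:M.
Proof.
rewrite (eq_tens (Z' := fun=> diag_mx (const_mx 1))) => [|k]; last first.
  by rewrite diag_const_mx.
rewrite tens_diag -diag_const_mx; congr diag_mx; apply/rowP => i.
by rewrite !mxE big1 // => k _; rewrite mxE.
Qed.

Lemma tens_delta x y : tens (fun k => delta_mx (slice x k) (slice y k)) = delta_mx x y.
Proof.
apply/matrixP => i j; rewrite !mxE; case: eqP => [->|ix]; last first.
  have /existsP[k ijk] : [exists k, slice i k != slice x k].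
    rewrite -negb_forall; apply/negP => /forallP e.
    by apply: ix; apply/eq_slice => k; apply/eqP.
  by rewrite (bigD1 k) //= mxE (negbTE ijk) mul0r.
case: eqP => [->|jy]; first by rewrite big1 // => k _; rewrite mxE !eqxx.
have /existsP[k ijk] : [exists k, slice j k != slice y k].
  rewrite -negb_forall; apply/negP => /forallP e.
  by apply: jy; apply/eq_slice => k; apply/eqP.
by rewrite (bigD1 k) //= mxE (negbTE ijk) andbF mul0r.
Qed.

Lemma tens_sum (I : finType) (Z : 'I_r -> I -> 'M[F]_N) :
  tens (fun k => \sum_x Z k x) = \sum_(f : {ffun 'I_r -> I}) tens (fun k => Z k (f k)).
Proof.
apply/matrixP => i j; rewrite summxE mxE.
under eq_bigr => k _ do rewrite summxE.
by rewrite bigA_distr_bigA; apply: eq_bigr => f _; rewrite mxE.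
Qed.

Lemma tens_scale (c : 'I_r -> F) Z :
  tens (fun k => c k *: Z k) = (\prod_k c k) *: tens Z.
Proof.
apply/matrixP => i j; rewrite !mxE -big_split; apply: eq_bigr => k _.
by rewrite mxE.
Qed.

Lemma tens_unit Z : (forall k, Z k \in unitmx) -> tens Z \in unitmx.
Proof.
move=> uZ; have /mulmx1_unit[] // : tens Z *m tens (fun k => invmx (Z k)) = 1%:M.
by rewrite tensM -tens1; apply: eq_tens => k; rewrite mulmxV.
Qed.

(** Multiplying by units reduces each factor to a [pid_mx]; the rank then counts the families of
    indices lying below the respective ranks. *)
Lemma rank_tens Z : \rank (tens Z) = (\prod_k \rank (Z k))%N.
Proof.
have -> : tens Z = tens (fun k => col_ebase (Z k)) *m
    tens (fun k => pid_mx (\rank (Z k))) *m tens (fun k => row_ebase (Z k)).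
  by rewrite !tensM; apply: eq_tens => k; rewrite mulmx_ebase.
have uL : tens (fun k => col_ebase (Z k)) \in unitmx.
  by apply: tens_unit => k; rewrite col_ebase_unit.
have uU : tens (fun k => row_ebase (Z k)) \in unitmx.
  by apply: tens_unit => k; rewrite row_ebase_unit.
rewrite mxrankMfree ?row_free_unit // -mxrank_tr trmx_mul.
rewrite mxrankMfree ?row_free_unit ?unitmx_tr // mxrank_tr.
pose P (i : 'I_D) := [forall k, slice i k < \rank (Z k)]%N.
have -> : tens (fun k => pid_mx (\rank (Z k))) = diag_mx (\row_i (P i)%:R).
  rewrite (eq_tens (Z' := fun k => diag_mx (\row_x (x < \rank (Z k))%N%:R))).
    rewrite tens_diag; congr diag_mx; apply/rowP => i; rewrite !mxE /P.
    case: forallP => [h|/forallP].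
      by rewrite big1 // => k _; rewrite mxE h.
    rewrite negb_forall => /existsP[k hk].
    by rewrite (bigD1 k) //= mxE (negbTE hk) mul0r.
  move=> k; apply/matrixP => x y; rewrite !mxE -[val x == val y]/(x == y).
  by case: (x == y).
rewrite rank_diag01.
rewrite cardsE -sum1_card big_mkcond /=.
transitivity (\sum_(f : {ffun 'I_r -> 'I_N}) \prod_k (f k < \rank (Z k))%N)%N.
  rewrite -big_slice; apply: eq_bigr => i _; rewrite -[_ \in _]/(P i) /P.
  case: forallP => [h|/forallP].
    by rewrite big1 // => k _; rewrite ffunE h.
  rewrite negb_forall => /existsP[k hk].
  by rewrite (bigD1 k) //= ffunE (negbTE hk) mul0n.
rewrite -(bigA_distr_bigA (fun k (x : 'I_N) => (x < \rank (Z k))%N : nat)).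
apply: eq_bigr => k _.
under eq_bigr => x _ do rewrite -[nat_of_bool _]muln1 mulnbl.
rewrite -big_mkcond (big_ord_narrow (rank_leq_row (Z k))) /=.
by rewrite sum1_card card_ord.
Qed.
End Tensors.

(** * The centraliser of the place permutations *)

Section Centraliser.
Variables (F : finFieldType) (t r n : nat).
Local Open Scope ring_scope.
Local Notation N := (pdim t n).
Local Notation D := (tdim t r n).

Definition placeT (s : 'I_r -> 'S_n) : 'M[F]_D := tens (fun k => place_mx F t (s k)).

Definition factor_act (s : 'S_r) (i : 'I_D) : 'I_D :=
  unslice (fun k => slice i ((s^-1)%g k)).

Definition factor_mx (s : 'S_r) : 'M[F]_D :=
  \matrix_(i, j) (j == factor_act s i)%:R.

Lemma factor_actK s : cancel (factor_act s) (factor_act s^-1).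
Proof.
by move=> i; apply: eq_slice => k; rewrite !unsliceK invgK permK.
Qed.

Lemma factor_actKV s : cancel (factor_act s^-1) (factor_act s).
Proof. by move=> i; rewrite -{1}(invgK s) factor_actK. Qed.

Lemma mul_factor_mx s (A : 'M[F]_D) i j : (factor_mx s *m A) i j = A (factor_act s i) j.
Proof.
rewrite mxE (bigD1 (factor_act s i)) //= mxE eqxx mul1r big1 ?addr0 // => k ki.
by rewrite mxE (negbTE ki) mul0r.
Qed.

Lemma mul_mx_factor s (A : 'M[F]_D) i j : (A *m factor_mx s) i j = A i (factor_act s^-1 j).
Proof.
rewrite mxE (bigD1 (factor_act s^-1 j)) //= mxE factor_actKV eqxx mulr1.
rewrite big1 ?addr0 // => k kj; rewrite mxE; case: eqP => [e|_]; last by rewrite mulr0.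
by rewrite e factor_actK eqxx in kj.
Qed.

Lemma factor_mxK s : factor_mx s^-1 *m factor_mx s = 1%:M.
Proof.
apply/matrixP => i j; rewrite mul_factor_mx !mxE factor_actKV.
by rewrite eq_sym.
Qed.

Lemma factor_mx1 : factor_mx 1 = 1%:M.
Proof.
apply/matrixP => i j; rewrite !mxE eq_sym; congr (_ == _)%:R.
by apply: eq_slice => k; rewrite unsliceK invg1 perm1.
Qed.

Lemma HmatE g s :
  Hmat F t r n g s = factor_mx s *m tens (fun k => tens_pow n (g k)).
Proof.
apply/matrixP => i j; rewrite mul_factor_mx !mxE exchange_big /=.
apply: eq_bigr => k _; rewrite mxE; apply: eq_bigr => m _.
by rewrite !tval_slice unsliceK.
Qed.

Lemma factor_tens s (Z : 'I_r -> 'M[F]_N) :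
  factor_mx s *m tens Z = tens (fun k => Z (s k)) *m factor_mx s.
Proof.
apply/matrixP => i j; rewrite mul_factor_mx mul_mx_factor !mxE.
rewrite (reindex_inj (@perm_inj _ s)) /=; apply: eq_bigr => k _.
by rewrite !unsliceK permK invgK.
Qed.

Definition centr (C : 'M[F]_D) : Prop :=
  forall s : 'I_r -> 'S_n, placeT s *m C = C *m placeT s.

(** Right multiplication by such an element preserves [centr_stable] ([centr_stableM]), so that the
    simplicity of a piece can be applied to the projection of a submodule. *)
Definition bicentr (b : 'M[F]_D) : Prop := forall C, centr C -> b *m C = C *m b.

Definition centr_stable (W : 'M[F]_D) : Prop := forall C, centr C -> (W *m C <= W)%MS.

Lemma centr_tens_pow (g : 'I_r -> 'M[F]_t) : centr (tens (fun k => tens_pow n (g k))).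
Proof.
by move=> s; rewrite !tensM; apply: eq_tens => k; rewrite tens_pow_place.
Qed.

Lemma centr_tens (Z : 'I_r -> 'M[F]_N) :
  (forall k s, place_mx F t s *m Z k = Z k *m place_mx F t s) -> centr (tens Z).
Proof. by move=> cZ s; rewrite !tensM; apply: eq_tens => k; rewrite cZ. Qed.

Lemma bicentrD a b : bicentr a -> bicentr b -> bicentr (a + b).
Proof. by move=> ca cb C cC; rewrite mulmxDl mulmxDr ca ?cb. Qed.

Lemma bicentrZ c a : bicentr a -> bicentr (c *: a).
Proof. by move=> ca C cC; rewrite -scalemxAl -scalemxAr ca. Qed.

Definition place_span (z : 'M[F]_N) : Prop :=
  exists c : 'S_n -> F, z = \sum_s c s *: place_mx F t s.

Lemma bicentr_tens (Z : 'I_r -> 'M[F]_N) :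
  (forall k, place_span (Z k)) -> bicentr (tens Z).
Proof.
move=> /fin_all_exists[c Zc] C cC.
rewrite (eq_tens Zc) tens_sum mulmx_suml mulmx_sumr; apply: eq_bigr => f _.
by rewrite tens_scale -scalemxAl -scalemxAr (cC (fun k => f k)).
Qed.

Lemma centr_stableM W b : centr_stable W -> bicentr b -> centr_stable (W *m b).
Proof. by move=> sW cb C cC; rewrite -mulmxA cb // mulmxA submxMr ?sW. Qed.

Definition avg (X : 'M[F]_D) : 'M[F]_D :=
  \sum_(s : {ffun 'I_r -> 'S_n}) placeT (fun k => (s k)^-1)%g *m X *m placeT s.

Lemma centr_avg X : centr (avg X).
Proof.
move=> u; rewrite mulmx_sumr mulmx_suml.
rewrite (reindex (fun s : {ffun 'I_r -> 'S_n} => [ffun k => (u k * s k)%g])) /=; last first.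
  exists (fun s : {ffun 'I_r -> 'S_n} => [ffun k => ((u k)^-1 * s k)%g]) => s _;
    by apply/ffunP => k; rewrite !ffunE ?mulKg ?mulKVg.
apply: eq_bigr => s _; rewrite -!mulmxA tensM !mulmxA tensM.
congr (_ *m _ *m _); apply: eq_tens => k; rewrite ffunE place_mxM //.
by rewrite invMg mulgKV.
Qed.

Lemma centr_avgE C : centr C -> avg C = ((n`! ^ r)%N%:R : F) *: C.
Proof.
move=> cC; rewrite /avg (eq_bigr (fun=> C)) => [|s _].
  by rewrite sumr_const card_ffun card_Sn card_ord scaler_nat.
rewrite cC -mulmxA tensM -[RHS]mulmx1 -tens1; congr (_ *m _).
by apply: eq_tens => k; rewrite place_mxK.
Qed.

Lemma avg_delta x y : avg (delta_mx x y) =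
  tens (fun k => \sum_(u : 'S_n)
    place_mx F t u^-1 *m delta_mx (slice x k) (slice y k) *m place_mx F t u).
Proof.
rewrite tens_sum; apply: eq_bigr => s _; rewrite -tens_delta !tensM.
exact: eq_tens.
Qed.

Lemma pow_span_stable (W : 'M[F]_D) (Z : 'I_r -> 'M[F]_N) :
  (forall g : 'I_r -> 'M[F]_t, (forall k, g k \in unitmx) ->
     (W *m tens (fun k => tens_pow n (g k)) <= W)%MS) ->
  (forall k, pow_span (Z k)) -> (W *m tens Z <= W)%MS.
Proof.
move=> sW /fin_all_exists[c Zc].
rewrite (eq_tens Zc).
(* Non-units get coefficient zero, so that [tens_sum] can expand over all matrices. *)
rewrite (eq_tens (Z' := fun k => \sum_(g : 'M[F]_t)
    (if g \in unitmx then c k g else 0) *: tens_pow n g)); last first.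
  move=> k; rewrite big_mkcond; apply: eq_bigr => g _.
  by case: ifP => // _; rewrite scale0r.
rewrite tens_sum mulmx_sumr; apply: summx_sub => f _; rewrite tens_scale -scalemxAr.
have [/forallP fu|] := boolP [forall k, f k \in unitmx].
  by rewrite scalemx_sub // sW.
rewrite negb_forall => /existsP[k /negbTE fk].
by rewrite (bigD1 k) //= fk mul0r scale0r sub0mx.
Qed.

(* Schur--Weyl density: the base group spans the centraliser of the place
   permutations, by polarisation. *)
Lemma base_stable_centr (W : 'M[F]_D) : (n < #|F|)%N -> n`!%:R != 0 :> F ->
  (forall g : 'I_r -> 'M[F]_t, (forall k, g k \in unitmx) ->
     (W *m tens (fun k => tens_pow n (g k)) <= W)%MS) ->
  centr_stable W.
Proof.
move=> nq n0 sW C cC.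
(* On the centraliser, averaging is multiplication by (n!)^r. Unlike C, [avg C] is visibly a
   combination of pure tensors of the matrices in [sym_delta_span]. *)
suff : (W *m avg C <= W)%MS.
  rewrite centr_avgE // -scalemxAr natrX => h.
  by rewrite -(eqmx_scale _ (expf_neq0 r n0)).
have -> : avg C = \sum_i \sum_j C i j *: avg (delta_mx i j).
  rewrite /avg; under [RHS]eq_bigr => i _ do
    (under eq_bigr => j _ do rewrite scaler_sumr; rewrite exchange_big).
  rewrite exchange_big /=; apply: eq_bigr => s _.
  rewrite {1}(matrix_sum_delta C) mulmx_sumr mulmx_suml; apply: eq_bigr => i _.
  rewrite mulmx_sumr mulmx_suml; apply: eq_bigr => j _.
  by rewrite -scalemxAr -scalemxAl.
rewrite mulmx_sumr; apply: summx_sub => i _; rewrite mulmx_sumr; apply: summx_sub => j _.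
rewrite -scalemxAr scalemx_sub // avg_delta; apply: pow_span_stable => // k.
exact: sym_delta_span.
Qed.

(* [E P E] is a scalar multiple of [E] for every place permutation [P], so
   averaging [E X E] over these and compressing by [E] gives back [E X E] up to
   an invertible scalar. *)
Lemma tens_simple (eta : 'I_r -> 'M[F]_N) (chi : 'I_r -> 'S_n -> F) U :
  (forall k, eta k *m eta k = eta k) ->
  (forall k s, eta k *m place_mx F t s *m eta k = chi k s *: eta k) ->
  (forall k, \sum_s chi k (s^-1)%g * chi k s != 0) ->
  centr_stable U -> (U <= tens eta)%MS -> U != 0 -> (tens eta <= U)%MS.
Proof.
move=> idE chiE chi0 sU UE; set E := tens eta => U0.
have EE : E *m E = E by rewrite tensM; apply: eq_tens.
have inE m (w : 'M_(m, D)) : (w <= E)%MS -> w *m E = w.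
  by case/submxP=> y ->; rewrite -mulmxA EE.
have [i wi] : exists i, row i U != 0.
  apply/existsP; apply: contraT; rewrite negb_exists => /forallP h.
  by case/eqP: U0; apply/row_matrixP => i; rewrite row0; move: (h i); rewrite negbK => /eqP.
set w := row i U in wi; have wU : (w <= U)%MS by apply: row_sub.
have wE : w *m E = w by apply: inE; apply: submx_trans UE.
have [j wj] : exists j, w 0 j != 0.
  apply/existsP; apply: contraT; rewrite negb_exists => /forallP h.
  by case/eqP: wi; apply/rowP => j; rewrite [RHS]mxE; move: (h j); rewrite negbK => /eqP.
have chiP (s : 'I_r -> 'S_n) : E *m placeT s *m E = (\prod_k chi k (s k)) *: E.
  by rewrite !tensM -tens_scale; apply: eq_tens => k; rewrite chiE.
apply/row_subP => l; rewrite rowE; set v := delta_mx 0 l.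
(* A matrix of rank one: it reads the non-zero coordinate j of w. It need not commute with anything;
   averaging repairs that. *)
have [X wX] : exists X : 'M[F]_D, w *m X = v.
  exists ((w 0 j)^-1 *: (delta_mx j 0 *m v)); rewrite -scalemxAr mulmxA -colE.
  have -> : col j w = (w 0 j)%:M.
    by apply/matrixP => a b; rewrite !ord1 [LHS]mxE [RHS]mxE.
  by rewrite mul_scalar_mx scalerA mulVf // scale1r.
have wZU : (w *m avg (E *m X *m E) <= U)%MS.
  exact: submx_trans (submxMr _ wU) (sU _ (centr_avg _)).
suff e : w *m avg (E *m X *m E) = (\prod_k \sum_s chi k (s^-1)%g * chi k s) *: (v *m E).
  move: wZU; rewrite e; have k0 : \prod_k \sum_s chi k (s^-1)%g * chi k s != 0.
    by apply/prodf_neq0 => k _.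
  by rewrite (eqmx_scale _ k0).
rewrite -(inE _ _ (submx_trans wZU UE)) mulmx_sumr mulmx_suml bigA_distr_bigA scaler_suml.
apply: eq_bigr => s _; rewrite big_split /= -scalerA.
rewrite -{1}wE !mulmxA -(mulmxA w) -(mulmxA w) (chiP (fun k => (s k)^-1)%g).
rewrite -scalemxAr -!scalemxAl -!mulmxA; congr (_ *: _).
rewrite (mulmxA E (placeT s)) chiP -!scalemxAr; congr (_ *: _).
by rewrite (mulmxA w E) wE mulmxA wX.
Qed.

End Centraliser.

(** * Submodules cut out by orthogonal idempotents *)

Section OrthogonalIdempotents.
Variables (F : fieldType) (d : nat) (I : finType) (P : pred I) (eps : I -> 'M[F]_d).
Local Open Scope ring_scope.
Hypothesis epsM : forall i j, P i -> P j -> eps i *m eps j = if i == j then eps i else 0.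

(** Stated for a duplicate-free sequence to allow the induction in [rank_sum_eps]. *)
Lemma eps_mul_sum (s : seq I) (Q : pred I) i :
  uniq s -> (forall j, Q j -> P j) -> P i ->
  eps i *m (\sum_(j <- s | Q j) eps j) = if (i \in s) && Q i then eps i else 0.
Proof.
move=> us QP Pi; rewrite mulmx_sumr.
case: ifP => [/andP[si Qi]|si].
  rewrite -big_filter (bigD1_seq i) ?filter_uniq ?mem_filter ?Qi //= epsM // eqxx.
  rewrite big1_seq ?addr0 // => j; rewrite mem_filter => /andP[ji /andP[Qj _]].
  by rewrite epsM ?(QP j) // eq_sym (negbTE ji).
rewrite big1_seq // => j /andP[Qj sj]; rewrite epsM ?(QP j) //.
by case: eqP => // e; rewrite e sj Qj in si.
Qed.

Lemma sum_mul_eps (s : seq I) (Q : pred I) i :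
  uniq s -> (forall j, Q j -> P j) -> P i ->
  (\sum_(j <- s | Q j) eps j) *m eps i = if (i \in s) && Q i then eps i else 0.
Proof.
move=> us QP Pi; rewrite mulmx_suml.
case: ifP => [/andP[si Qi]|si].
  rewrite -big_filter (bigD1_seq i) ?filter_uniq ?mem_filter ?Qi //= epsM // eqxx.
  rewrite big1_seq ?addr0 // => j; rewrite mem_filter => /andP[ji /andP[Qj _]].
  by rewrite epsM ?(QP j) // (negbTE ji).
rewrite big1_seq // => j /andP[Qj sj]; rewrite epsM ?(QP j) //.
by case: eqP => // e; rewrite -e sj Qj in si.
Qed.

Lemma sum_eps_idem (s : seq I) (Q : pred I) :
  uniq s -> (forall j, Q j -> P j) ->
  (\sum_(j <- s | Q j) eps j) *m (\sum_(j <- s | Q j) eps j) = \sum_(j <- s | Q j) eps j.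
Proof.
move=> us QP; rewrite {1}mulmx_suml big_seq_cond [RHS]big_seq_cond.
by apply: eq_bigr => i /andP[si Qi]; rewrite eps_mul_sum ?QP // si Qi.
Qed.

Lemma add_idem (A B : 'M[F]_d) : A *m A = A -> B *m B = B ->
  A *m B = 0 -> B *m A = 0 -> (A + B) *m (A + B) = A + B.
Proof. by move=> AA BB AB BA; rewrite mulmxDl !mulmxDr AA BB AB BA addr0 add0r. Qed.

Lemma add_orth (A B C E : 'M[F]_d) : A *m C = 0 -> A *m E = 0 ->
  B *m C = 0 -> B *m E = 0 -> (A + B) *m (C + E) = 0.
Proof. by move=> h1 h2 h3 h4; rewrite mulmxDl !mulmxDr h1 h2 h3 h4 !addr0. Qed.

(** A = A(A + B) and B = B(A + B) show that the row space is the sum of both; a vector in both is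
    fixed by A and killed by A. *)
Lemma rank_add_orth (A B : 'M[F]_d) : A *m A = A -> B *m B = B ->
  A *m B = 0 -> B *m A = 0 -> \rank (A + B)%R = (\rank A + \rank B)%N.
Proof.
move=> AA BB AB BA; rewrite -mxrank_disjoint_sum.
  apply: eqmx_rank; apply/andP; split; first by rewrite addmx_sub_adds.
  rewrite addsmx_sub; apply/andP; split.
    by apply/submxP; exists A; rewrite mulmxDr AA AB addr0.
  by apply/submxP; exists B; rewrite mulmxDr BB BA add0r.
apply/eqP; rewrite -submx0; set C := (A :&: B)%MS.
have : (C <= A)%MS by apply: capmxSl.
have /submxP[y CB] : (C <= B)%MS by apply: capmxSr.
case/submxP=> z CA; suff -> : C = 0 by [].
by rewrite CA -AA mulmxA -CA CB -mulmxA BA mulmx0.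
Qed.

Lemma rank_sum_eps (Q : pred I) : (forall j, Q j -> P j) ->
  \rank (\sum_(i | Q i) eps i)%R = (\sum_(i | Q i) \rank (eps i))%N.
Proof.
move=> QP; have := index_enum_uniq I.
elim: (index_enum I) => [|i s IHs] /=; first by rewrite !big_nil mxrank0.
case/andP=> si us; rewrite !big_cons; case: ifP => [Qi|_]; last exact: IHs.
rewrite rank_add_orth ?IHs ?sum_eps_idem //.
- by rewrite epsM ?QP // eqxx.
- by rewrite eps_mul_sum ?QP // (negbTE si).
- by rewrite sum_mul_eps ?QP // (negbTE si).
Qed.
End OrthogonalIdempotents.

(** * Submodules of a Lie power as orbit-stable sets of pieces *)

Section Decomposition.
Variables (F : finFieldType) (t r n : nat).
Variables (I : finType) (P : pred I) (eps : I -> 'M[F]_(tdim t r n)) (act : 'S_r -> I -> I).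
Local Open Scope ring_scope.
Local Notation L := (LiePow F t r n).
Hypothesis nq : (n < #|F|)%N.
Hypothesis n0 : n`!%:R != 0 :> F.
Hypothesis epsM : forall i j, P i -> P j -> eps i *m eps j = if i == j then eps i else 0.
Hypothesis epsL : (L :=: (\sum_(i | P i) eps i)%R)%MS.
Hypothesis eps_bicentr : forall i, P i -> bicentr (eps i).
Hypothesis eps_stable : forall i W, P i -> centr_stable W -> (W <= L)%MS -> (W *m eps i <= W)%MS.
Hypothesis eps_simple : forall i U, P i ->
  centr_stable U -> (U <= eps i)%MS -> U != 0 -> (eps i <= U)%MS.
Hypothesis actP : forall s i, P i -> P (act s i).
Hypothesis actK : forall s i, act s^-1%g (act s i) = i.
Hypothesis eps_act : forall s i, P i ->
  eps i *m factor_mx F t n s = factor_mx F t n s *m eps (act s i).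

Lemma Hsubmod_centr W : Hsubmod F t r n W -> centr_stable W.
Proof.
case=> _ sW; apply: base_stable_centr => // g gu.
by have := sW g 1%g gu; rewrite HmatE factor_mx1 mul1mx.
Qed.

Lemma Hsubmod_act W i s : Hsubmod F t r n W -> P i ->
  (eps i <= W)%MS -> (eps (act s i) <= W)%MS.
Proof.
case=> _ sW Pi iW.
have -> : eps (act s i) = factor_mx F t n s^-1 *m (eps i *m factor_mx F t n s).
  by rewrite eps_act // mulmxA factor_mxK mul1mx.
apply: mulmx_sub; apply: submx_trans (submxMr _ iW) _.
have := sW (fun=> 1%:M) s (fun=> unitmx1 _ _); rewrite HmatE.
rewrite (eq_tens (Z' := fun=> 1%:M)) => [|k]; last exact: tens_pow1.
by rewrite tens1 mulmx1.
Qed.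

(** W is the sum of its projections [W *m eps i]. Each of these lies in W by [eps_stable], which
    excludes diagonal submodules, and is zero or all of [eps i] by simplicity. *)
Lemma Hsubmod_sum W : Hsubmod F t r n W ->
  (W :=: (\sum_(i | P i && (eps i <= W)%MS) eps i)%R)%MS.
Proof.
move=> HW; have cW := Hsubmod_centr HW; case: (HW) => WL _.
apply/eqmxP/andP; split; last by apply: summx_sub => i /andP[].
have WE : W = \sum_(i | P i) W *m eps i.
  rewrite -mulmx_sumr; move: WL; rewrite epsL => /submxP[y ->].
  by rewrite -mulmxA (sum_eps_idem epsM) ?index_enum_uniq.
rewrite {1}WE; apply: summx_sub => i Pi; have [iW|iW] := boolP (eps i <= W)%MS.
  apply: submx_trans (submxMl _ _) _; apply/submxP; exists (eps i).
  rewrite (eps_mul_sum epsM) ?index_enum_uniq ?mem_index_enum ?Pi ?iW //.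
  by move=> j /andP[].
have -> : W *m eps i = 0; last by rewrite sub0mx.
apply/eqP; apply: contraNT iW => Wi.
apply: submx_trans (eps_stable Pi cW WL); apply: eps_simple Wi => //.
  by apply: centr_stableM; last exact: eps_bicentr.
exact: submxMl.
Qed.

Lemma rank_LiePow : \rank L = (\sum_(i | P i) \rank (eps i))%N.
Proof. by rewrite epsL (rank_sum_eps epsM). Qed.

Lemma Hsubmod_corank W : Hsubmod F t r n W ->
  (\rank L - \rank W)%N = (\sum_(i | P i && ~~ (eps i <= W)%MS) \rank (eps i))%N.
Proof.
move=> HW; rewrite (Hsubmod_sum HW) (rank_sum_eps epsM); last by move=> j /andP[].
by rewrite rank_LiePow (bigID (fun i => (eps i <= W)%MS)) /= addKn.
Qed.

Lemma sum_Hsubmod (Q : pred I) : (forall i, Q i -> P i) ->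
  (forall s i, Q i -> Q (act s i)) -> Hsubmod F t r n (\sum_(i | Q i) eps i).
Proof.
move=> QP Qact; have inS i : Q i -> (eps i <= (\sum_(i | Q i) eps i)%R)%MS.
  move=> Qi; apply/submxP; exists (eps i).
  by rewrite (eps_mul_sum epsM) ?QP ?index_enum_uniq // mem_index_enum Qi.
split.
  rewrite epsL; apply: summx_sub => i Qi; apply/submxP; exists (eps i).
  by rewrite (eps_mul_sum epsM) ?index_enum_uniq // ?mem_index_enum QP.
move=> g s gu; rewrite HmatE mulmx_suml; apply: summx_sub => i Qi.
rewrite mulmxA eps_act ?QP // -mulmxA (eps_bicentr _ (centr_tens_pow _)) ?QP ?Qact //.
by rewrite mulmxA; apply: mulmx_sub; apply: inS; apply: Qact.
Qed.

(** A quotient has the dimension of the pieces missing from W, and these form an [act]-stable set. A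
    piece of positive rank is required in Q because some pieces may vanish, such as those with a
    factor (111) when t = 2. *)
Lemma min_quot_dim_sum (O : pred I) (d : nat) : (forall i, O i -> P i) ->
  (forall s i, O i -> O (act s i)) ->
  d = (\sum_(i | O i) \rank (eps i))%N -> (0 < d)%N ->
  (forall Q : pred I, (forall i, Q i -> P i) -> (forall s i, Q i -> Q (act s i)) ->
     (exists2 i, Q i & (0 < \rank (eps i))%N) -> (d <= \sum_(i | Q i) \rank (eps i))%N) ->
  min_quot_dim F t r n d.
Proof.
move=> OP Oact dE d0 dmin; split.
  pose Q i := P i && ~~ O i.
  have QP i : Q i -> P i by case/andP.
  have LE : \rank L = (d + \sum_(i | Q i) \rank (eps i))%N.
    rewrite rank_LiePow (bigID O) /= dE; congr (_ + _)%N.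
    by apply: eq_bigl => i; case Oi: (O i); rewrite ?andbF // OP.
  exists (\sum_(i | Q i) eps i); split; last first.
    by rewrite (rank_sum_eps epsM) // LE addnK -[X in (X < _)%N]add0n ltn_add2r.
  apply: sum_Hsubmod => // s i /andP[Pi Oi]; rewrite /Q actP //=.
  by apply: contra Oi => /(Oact s^-1%g); rewrite actK.
move=> W HW Wlt; rewrite (Hsubmod_corank HW); apply: dmin.
- by move=> i /andP[].
- move=> s i /andP[Pi iW]; rewrite actP //=; apply: contra iW => siW.
  by have := Hsubmod_act s^-1%g HW (actP s Pi) siW; rewrite actK.
- apply/exists_inP; apply: contraT; rewrite negb_exists_in => /forall_inP h.
  have : (0 < \rank L - \rank W)%N by rewrite subn_gt0.
  by rewrite (Hsubmod_corank HW) big1 // => i /h; rewrite lt0n negbK => /eqP.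
Qed.

Lemma min_quot_dim_reducible d : min_quot_dim F t r n d ->
  (d < \sum_(i | P i) \rank (eps i))%N -> Hreducible F t r n.
Proof.
case=> -[W [HW [Wlt WE]]] _; rewrite -rank_LiePow => dL.
exists W; split=> //; split=> //; case: posnP => // W0.
by move: dL; rewrite -WE W0 subn0 ltnn.
Qed.

Lemma Hirreducible_sum : (0 < \sum_(i | P i) \rank (eps i))%N ->
  (forall Q : pred I, (forall i, Q i -> P i) -> (forall s i, Q i -> Q (act s i)) ->
     (exists i, Q i) -> (\sum_(i | Q i) \rank (eps i) = \sum_(i | P i) \rank (eps i))%N) ->
  Hirreducible F t r n.
Proof.
rewrite -rank_LiePow => L0 h; split=> // W HW.
have QP i : P i && (eps i <= W)%MS -> P i by case/andP.
rewrite (Hsubmod_sum HW) (rank_sum_eps epsM) //.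
have [/existsP[i Qi]|] := boolP [exists i, P i && (eps i <= W)%MS]; last first.
  by rewrite negb_exists => /forallP h0; left; rewrite big1 // => i; rewrite (negbTE (h0 i)).
right; rewrite h //; last by exists i.
by move=> s j /andP[Pj jW]; rewrite actP //= Hsubmod_act.
Qed.

End Decomposition.

(** * Symmetrisers and antisymmetrisers *)

Section SignedSymmetrisers.
Variables (F : finFieldType) (t n : nat).
Local Open Scope ring_scope.
Local Notation N := (pdim t n).
Hypothesis n0 : n`!%:R != 0 :> F.

Definition sgn_char (b : bool) (s : 'S_n) : F := (-1) ^+ (b && odd_perm s).

Lemma sgn_charM b s u : sgn_char b (s * u)%g = sgn_char b s * sgn_char b u.
Proof.
by rewrite /sgn_char; case: b; rewrite /= ?mulr1 // odd_permM signr_addb.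
Qed.

Lemma sgn_charV b s : sgn_char b s^-1%g = sgn_char b s.
Proof. by rewrite /sgn_char odd_permV. Qed.

Lemma sgn_charK b s : sgn_char b s * sgn_char b s = 1.
Proof. by rewrite -{1}sgn_charV -sgn_charM mulVg /sgn_char odd_perm1 andbF. Qed.

(* The symmetriser ([b = false]) and the antisymmetriser ([b = true]). *)
Definition sgn_idem (b : bool) : 'M[F]_N :=
  n`!%:R^-1 *: \sum_s sgn_char b s *: place_mx F t s.

Lemma place_sgn_idem b s : place_mx F t s *m sgn_idem b = sgn_char b s *: sgn_idem b.
Proof.
rewrite -scalemxAr scalerA mulrC -scalerA; congr (_ *: _).
rewrite mulmx_sumr scaler_sumr (reindex_inj (mulIg s^-1%g)) /=; apply: eq_bigr => u _.
rewrite -scalemxAr place_mxM mulgKV sgn_charM sgn_charV scalerA.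
by rewrite mulrC.
Qed.

Lemma sgn_idem_place b s : sgn_idem b *m place_mx F t s = sgn_char b s *: sgn_idem b.
Proof.
rewrite -scalemxAl scalerA mulrC -scalerA; congr (_ *: _).
rewrite mulmx_suml scaler_sumr (reindex_inj (mulgI s^-1%g)) /=; apply: eq_bigr => u _.
by rewrite -scalemxAl place_mxM mulKVg sgn_charM sgn_charV scalerA.
Qed.

Lemma sgn_idem_idem b : sgn_idem b *m sgn_idem b = sgn_idem b.
Proof.
rewrite {1}/sgn_idem -scalemxAl mulmx_suml (eq_bigr (fun=> sgn_idem b)) => [|s _].
  by rewrite sumr_const card_Sn -scaler_nat scalerA mulVf // scale1r.
by rewrite -scalemxAl place_sgn_idem scalerA sgn_charK scale1r.
Qed.

Lemma two_neq0 : (1 < n)%N -> 2%:R != 0 :> F.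
Proof.
move=> n1; apply: contra n0 => /eqP h; have /dvdnP[k ->] : (2 %| n`!)%N by rewrite dvdn_fact.
by rewrite natrM h mulr0.
Qed.

Lemma sgn_idem_orth b b' : (1 < n)%N -> b != b' -> sgn_idem b *m sgn_idem b' = 0.
Proof.
move=> n1 bb'; pose u : 'S_n := tperm (Ordinal (ltnW n1)) (Ordinal n1).
have h : sgn_char b u *: (sgn_idem b *m sgn_idem b') =
         sgn_char b' u *: (sgn_idem b *m sgn_idem b').
  by rewrite scalemxAl -sgn_idem_place -mulmxA place_sgn_idem scalemxAr.
apply/eqP; move: h; rewrite /sgn_char odd_tperm /= => /eqP.
rewrite -subr_eq0 -scalerBl scaler_eq0 => /orP[|//].
case: b b' bb' => -[] //= _; rewrite ?expr0 ?expr1 -?opprD ?opprK ?oppr_eq0;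
  by rewrite -[1 + 1]/(2%:R) (negbTE (two_neq0 n1)).
Qed.

Lemma place_span_sgn_idem b : place_span (sgn_idem b).
Proof.
exists (fun s => n`!%:R^-1 * sgn_char b s); rewrite /sgn_idem scaler_sumr.
by apply: eq_bigr => s _; rewrite scalerA.
Qed.

Lemma sgn_idem_char b s :
  sgn_idem b *m place_mx F t s *m sgn_idem b = sgn_char b s *: sgn_idem b.
Proof. by rewrite sgn_idem_place -scalemxAl sgn_idem_idem. Qed.

Lemma sum_sgn_char b : \sum_s sgn_char b s^-1%g * sgn_char b s != 0.
Proof.
under eq_bigr => s _ do rewrite sgn_charV sgn_charK.
by rewrite sumr_const card_Sn.
Qed.

Lemma sgn_idemE b i j : sgn_idem b i j =
  n`!%:R^-1 * \sum_s sgn_char b s * (ptup j == place_act (ptup i) s)%:R.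
Proof.
rewrite mxE summxE; congr (_ * _); apply: eq_bigr => s _.
by rewrite mxE mxE.
Qed.

(** A sigma type, so that the sorting permutation can serve as data when choosing orbit
    representatives. *)
Lemma sort_place (x : n.-tuple 'I_t) :
  {s : 'S_n | sorted leq (map val (place_act x s))}.
Proof.
apply: sigW; pose le (a b : 'I_t) := (a <= b)%N.
have : perm_eq (sort le x) x by rewrite perm_sort.
case/tuple_permP => s e; exists s; rewrite -[val _]e.
by rewrite sorted_map; apply: sort_sorted => a b; apply: leq_total.
Qed.

Lemma sorted_place_eq (x : n.-tuple 'I_t) s :
  sorted leq (map val x) -> sorted leq (map val (place_act x s)) -> place_act x s = x.
Proof.
move=> sx sy; apply/val_inj/(inj_map val_inj).
apply: (sorted_eq leq_trans anti_leq) => //.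
by apply/perm_map/tuple_permP; exists s.
Qed.

(** The order of a stabiliser divides n!. Up to the factor 1/n! it is a diagonal entry of the
    symmetriser. *)
Lemma card_place_stab (x : n.-tuple 'I_t) :
  #|[set s : 'S_n | place_act x s == x]|%:R != 0 :> F.
Proof.
have gS : group_set [set s : 'S_n | place_act x s == x].
  apply/group_setP; split; first by rewrite inE place_act1.
  move=> s u; rewrite !inE => /eqP sx /eqP ux.
  by rewrite -place_actM ux sx.
have := cardSg (subsetT (Group gS)); rewrite /= cardsT card_Sn => /dvdnP[k e].
by apply: contra n0 => /eqP h; rewrite e natrM h mulr0.
Qed.

Lemma mem_prank_imset (S : {set n.-tuple 'I_t}) (i : 'I_N) :
  (i \in [set prank x | x in S]) = (ptup i \in S).
Proof.
apply/imsetP/idP => [[x xS ->]|iS]; first by rewrite prankK.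
by exists (ptup i); rewrite ?ptupK.
Qed.

End SignedSymmetrisers.

(** * Dimensions of symmetric and exterior powers *)

Section Ranks.
Variables (F : finFieldType) (t n : nat).
Local Open Scope ring_scope.
Hypothesis n0 : n`!%:R != 0 :> F.

Lemma sgn_idem_sort b i (s : 'S_n) j : sgn_idem F t n b i j =
  sgn_char F b s * sgn_idem F t n b (prank (place_act (ptup i) s)) j.
Proof. by rewrite -mul_place_mx place_sgn_idem // [RHS]mulrC [X in _ = X * _]mxE mulrC mulrA sgn_charK mul1r. Qed.

Lemma rank_symmetriser_tuples : \rank (sgn_idem F t n false) =
  #|[set x : n.-tuple 'I_t | sorted leq (map val x)]|.
Proof.
rewrite -(card_imset _ (can_inj (@prankK t n))).
apply: (@rank_of_reps F (pdim t n) _ _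
  (fun i => prank (place_act (ptup i) (sval (sort_place (ptup i))))) (fun=> 1)
  (fun i => n`!%:R^-1 * #|[set s : 'S_n | place_act (ptup i) s == ptup i]|%:R)).
- by move=> i j; rewrite (sgn_idem_sort _ _ (sval (sort_place (ptup i)))).
- by move=> i _; rewrite mem_prank_imset prankK inE; apply: (svalP (sort_place _)).
- move=> i j; rewrite !mem_prank_imset !inE => si sj; rewrite sgn_idemE.
  rewrite -mulrnAr; congr (_ * _); have [<-|ij] := eqVneq i j.
    rewrite mulr1n -sum1_card natr_sum [RHS]big_mkcond /=; apply: eq_bigr => s _.
    by rewrite inE mul1r eq_sym; case: eqP.
  rewrite mulr0n big1 // => s _; case: eqP => [e|]; last by rewrite mulr0.
  case/eqP: ij; apply: (can_inj (@ptupK t n)); rewrite e sorted_place_eq //.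
  by rewrite -e.
- by move=> i _; rewrite mulf_neq0 ?invr_eq0 ?card_place_stab.
Qed.

Lemma rank_antisymmetriser : (1 < n)%N -> \rank (sgn_idem F t n true) = 'C(t, n).
Proof.
move=> n1; rewrite -card_ltn_sorted_tuples -(card_imset _ (can_inj (@prankK t n))).
have uniq_act (x : n.-tuple 'I_t) s : uniq (place_act x s) = uniq x.
  by apply: perm_uniq; apply/tuple_permP; exists s.
apply: (@rank_of_reps F (pdim t n) _ _
  (fun i => prank (place_act (ptup i) (sval (sort_place (ptup i)))))
  (fun i => if uniq (ptup i) then sgn_char F true (sval (sort_place (ptup i))) else 0)
  (fun i => n`!%:R^-1)).
- move=> i j; case: ifPn => [_|nu]; first exact: sgn_idem_sort.
  rewrite mul0r.
  (* Exchanging two equal entries fixes the tuple but negates its row, which is therefore zero. *)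
  have [m [m' mm' e]] : exists m, exists2 m', m != m' & tnth (ptup i) m = tnth (ptup i) m'.
    move: nu => /tuple_uniqP nu.
    have : ~~ injectiveb (tnth (ptup i)) by apply/injectiveP.
    by case/injectivePn => m [m' mm' e]; exists m, m'.
  have := sgn_idem_sort true i (tperm m m') j.
  have -> : place_act (ptup i) (tperm m m') = ptup i.
    by apply: eq_from_tnth => l; rewrite tnth_mktuple; case: tpermP => [->|->|].
  rewrite ptupK /sgn_char odd_tperm mm' expr1 mulN1r => /eqP.
  rewrite -addr_eq0 -mulr2n -mulr_natl mulf_eq0 (negbTE (two_neq0 n0 n1)) => /eqP //.
- move=> i; case: ifPn => [u _|_]; last by rewrite eqxx.
  rewrite mem_prank_imset prankK inE ltn_sorted_uniq_leq (map_inj_uniq val_inj) uniq_act u.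
  exact: (svalP (sort_place _)).
- move=> i j; rewrite !mem_prank_imset !inE !ltn_sorted_uniq_leq.
  rewrite (map_inj_uniq val_inj) => /andP[ui si] /andP[_ sj]; rewrite sgn_idemE.
  rewrite -[n`!%:R^-1 in RHS]mulr1 -mulrnAr; congr (_ * _); have [<-|ij] := eqVneq i j.
    rewrite mulr1n (bigD1 1%g) //= place_act1 eqxx mulr1 /sgn_char odd_perm1 expr0.
    rewrite big1 ?addr0 // => s s1; case: eqP => [e|]; last by rewrite mulr0.
    case/eqP: s1; apply/permP => m; rewrite perm1; apply/eqP.
    rewrite -(inj_eq (elimT (tuple_uniqP _) ui)).
    by rewrite {2}e tnth_mktuple.
  rewrite mulr0n big1 // => s _; case: eqP => [e|]; last by rewrite mulr0.
  case/eqP: ij; apply: (can_inj (@ptupK t n)); rewrite e sorted_place_eq //.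
  by rewrite -e.
- by move=> i _; rewrite invr_eq0.
Qed.
End Ranks.

Lemma rank_symmetriser (F : finFieldType) (t n : nat) :
  (n`!%:R != 0 :> F)%R -> \rank (sgn_idem F t.+1 n false) = 'C(n + t, n).
Proof. by move=> n0; rewrite rank_symmetriser_tuples // card_sorted_tuples. Qed.

(** * The second Lie power *)

Section LieBrackets.
Variables (F : finFieldType) (t r : nat).
Local Open Scope ring_scope.

Lemma tcoord_inj n (x y : 'rV[F]_(tdim t r n)) :
  (forall c, tcoord F t r n x c = tcoord F t r n y c) -> x = y.
Proof.
by move=> e; apply/rowP => j; have := e (Defs.tval t r n j); rewrite /tcoord enum_valK.
Qed.

Lemma tcoord_lbr n (x : 'rV[F]_(tdim t r n)) v c :
  tcoord F t r n.+1 (lbr F t r n x v) c =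
  tcoord F t r n x [ffun i : 'I_n => c (widen_ord (leqnSn n) i)] *
    tcoord F t r 1 v [ffun _ : 'I_1 => c ord_max] -
  tcoord F t r 1 v [ffun _ : 'I_1 => c ord0] *
    tcoord F t r n x [ffun i : 'I_n => c (lift ord0 i)].
Proof. by rewrite /tcoord !mxE /Defs.tval enum_rankK. Qed.

Lemma tcoord_delta n i c :
  tcoord F t r n (delta_mx 0 i) c = (c == Defs.tval t r n i)%:R.
Proof. by rewrite /tcoord mxE /= (can2_eq (@enum_rankK _) (@enum_valK _)). Qed.

Lemma tcoordD n x y c :
  tcoord F t r n (x + y) c = tcoord F t r n x c + tcoord F t r n y c.
Proof. by rewrite /tcoord mxE. Qed.

Lemma tcoordN n x c : tcoord F t r n (- x) c = - tcoord F t r n x c.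
Proof. by rewrite /tcoord mxE. Qed.

Lemma tcoordZ n a x c : tcoord F t r n (a *: x) c = a * tcoord F t r n x c.
Proof. by rewrite /tcoord mxE. Qed.

Lemma tcoord_place n x (s : 'S_n) c :
  tcoord F t r n (x *m placeT F t (fun=> s)) c =
  tcoord F t r n x [ffun m => c (s^-1%g m)].
Proof.
rewrite /tcoord mxE (bigD1 (enum_rank [ffun m => c (s^-1%g m)])) //=.
have sl d k : slice (enum_rank d) k = prank [tuple d m k | m < n] :> 'I_(pdim t n).
  by rewrite /slice /Defs.tval enum_rankK.
rewrite mxE big1 ?mulr1 => [|k _]; last first.
  rewrite mxE !sl !prankK (_ : _ == _) //; apply/eqP/eq_from_tnth => m.
  by rewrite !tnth_mktuple ffunE permK.
rewrite big1 ?addr0 // => j jn; rewrite mxE.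
have [/forallP e|] := boolP [forall k, ptup (slice (enum_rank c) k) ==
                                      place_act (ptup (slice j k)) s].
  case/eqP: jn; apply: eq_slice => k; rewrite sl -[LHS]ptupK; congr prank.
  rewrite -[LHS](place_actK _ s) -(eqP (e k)) sl prankK; apply: eq_from_tnth => m.
  by rewrite !tnth_mktuple ffunE.
by rewrite negb_forall => /existsP[k /negbTE ek]; rewrite (bigD1 k) //= mxE ek mul0r mulr0.
Qed.

Definition tvec1 (a : Idx t r) : 'rV[F]_(tdim t r 1) :=
  delta_mx 0 (enum_rank ([ffun=> a] : Tidx t r 1)).

Lemma tcoord_tvec1 a b : tcoord F t r 1 (tvec1 a) [ffun=> b] = (b == a)%:R.
Proof.
rewrite tcoord_delta /Defs.tval enum_rankK; congr (nat_of_bool _)%:R.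
by apply/idP/idP => /eqP; [move/ffunP/(_ ord0); rewrite !ffunE => ->|move->].
Qed.

Lemma LiePowS n : LiePow F t r n.+2 =
  (\sum_(x : 'rV[F]_(tdim t r n.+1) | (x <= LiePow F t r n.+1)%MS)
     \sum_(v : 'rV[F]_(tdim t r 1)) <<lbr F t r n.+1 x v>>)%MS.
Proof. by []. Qed.

Lemma lbr_LiePow n x v : (x <= LiePow F t r n.+1)%MS ->
  (lbr F t r n.+1 x v <= LiePow F t r n.+2)%MS.
Proof.
move=> xL; rewrite LiePowS (sumsmx_sup x) // (sumsmx_sup v) //.
by rewrite genmxE.
Qed.

Lemma LiePow_sub n m (A : 'M[F]_(m, tdim t r n.+2)) :
  (forall x v, (x <= LiePow F t r n.+1)%MS -> (lbr F t r n.+1 x v <= A)%MS) ->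
  (LiePow F t r n.+2 <= A)%MS.
Proof.
move=> h; rewrite LiePowS; apply/sumsmx_subP => x xL; apply/sumsmx_subP => v _.
by rewrite genmxE h.
Qed.

Definition swap2 : 'S_2 := tperm ord0 ord_max.

Definition alt2 : 'M[F]_(tdim t r 2) := 2%:R^-1 *: (1%:M - placeT F t (fun=> swap2)).

Lemma tcoord_lbr1 x v (c : Tidx t r 2) : tcoord F t r 2 (lbr F t r 1 x v) c =
  tcoord F t r 1 x [ffun=> c ord0] * tcoord F t r 1 v [ffun=> c ord_max] -
  tcoord F t r 1 v [ffun=> c ord0] * tcoord F t r 1 x [ffun=> c ord_max].
Proof.
rewrite tcoord_lbr.
have -> : [ffun i : 'I_1 => c (widen_ord (leqnSn 1) i)] = [ffun=> c ord0].
  by apply/ffunP => i; rewrite !ffunE; congr (c _); apply: val_inj; rewrite /= ord1.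
have -> // : [ffun i : 'I_1 => c (lift ord0 i)] = [ffun=> c ord_max].
by apply/ffunP => i; rewrite !ffunE; congr (c _); apply: val_inj; rewrite /= ord1.
Qed.

Lemma tcoord_swap2 x c : tcoord F t r 2 (x *m placeT F t (fun=> swap2)) c =
  tcoord F t r 2 x [ffun m => c (swap2 m)].
Proof. by rewrite tcoord_place /swap2 tpermV. Qed.

Lemma alt2_id m (x : 'M[F]_(m, _)) : 2%:R != 0 :> F ->
  x *m placeT F t (fun=> swap2) = - x -> x *m alt2 = x.
Proof.
move=> F2 e; rewrite -scalemxAr mulmxBr mulmx1 e opprK -mulr2n -scaler_nat.
by rewrite scalerA mulVf // scale1r.
Qed.

(** A bracket is negated by the swap, hence fixed by [alt2]. Conversely, each row of [alt2] is half
    the bracket of two basis vectors. *)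
Lemma LiePow2 : 2%:R != 0 :> F -> (LiePow F t r 2 :=: alt2)%MS.
Proof.
move=> F2; apply/eqmxP/andP; split.
  apply: LiePow_sub => x v _; rewrite -[lbr _ _ _ _ _ _]alt2_id ?submxMl //.
  apply: tcoord_inj => c; rewrite tcoord_swap2 tcoordN !tcoord_lbr1 !ffunE.
  by rewrite tpermL tpermR; ring.
apply/row_subP => i; rewrite rowE.
have -> : delta_mx 0 i *m alt2 = 2%:R^-1 *: lbr F t r 1
    (tvec1 (Defs.tval t r 2 i ord0)) (tvec1 (Defs.tval t r 2 i ord_max)).
  rewrite -scalemxAr mulmxBr mulmx1; congr (_ *: _); apply: tcoord_inj => c.
  rewrite tcoordD tcoordN tcoord_swap2 tcoord_lbr1 !tcoord_tvec1 !tcoord_delta.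
  have eqT (d d' : Tidx t r 2) : (d == d') = (d ord0 == d' ord0) && (d ord_max == d' ord_max).
    apply/eqP/andP => [->//|[/eqP e0 /eqP e1]]; apply/ffunP => m.
    have [->|m0] := eqVneq m ord0; first by [].
    by rewrite (_ : m = ord_max) //; apply: val_inj; case: m m0 => -[|[|]].
  by rewrite !eqT !ffunE tpermL tpermR -!natrM !mulnb (andbC (c ord_max == _)).
by rewrite scalemx_sub // lbr_LiePow // submx1.
Qed.

End LieBrackets.

(** * The pieces of the second Lie power, indexed by the set of alternating factors *)

Section LieSquare.
Variables (F : finFieldType) (t r : nat).
Local Open Scope ring_scope.
Hypothesis F2 : 2%:R != 0 :> F.
Local Notation I := {ffun 'I_r -> bool}.

Let n0 : (2`!)%:R != 0 :> F := F2.

Definition sgn_weight (f : I) : nat := #|[set k | f k]|.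

Definition eps2 (f : I) : 'M[F]_(tdim t r 2) := tens (fun k => sgn_idem F t 2 (f k)).

Lemma big_S2 (V : zmodType) (G : 'S_2 -> V) : \sum_s G s = G 1%g + G swap2.
Proof.
rewrite (bigD1 1%g) //= (bigD1 swap2) /=; last first.
  by apply/eqP => /permP/(_ ord0); rewrite tpermL perm1.
rewrite big_pred0 ?addr0 // => s; apply/negbTE; rewrite negb_and !negbK.
have /subset_leq_card : [set 1%g; swap2] \subset [set: 'S_2] by apply: subsetT.
have c2 : #|[set 1%g; swap2 : 'S_2]| = #|[set: 'S_2]|.
  rewrite cards2 cardsT card_Sn (_ : 1%g != swap2) //.
  by apply/eqP => /permP/(_ ord0); rewrite tpermL perm1.
move=> _; have /eqP e : [set 1%g; swap2] == [set: 'S_2] by rewrite eqEcard subsetT c2 leqnn.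
by have := in_setT s; rewrite -e !inE.
Qed.

Lemma sgn_idem2E b :
  sgn_idem F t 2 b = 2%:R^-1 *: (1%:M + (-1) ^+ b *: place_mx F t swap2).
Proof.
rewrite /sgn_idem big_S2 /sgn_char odd_perm1 odd_tperm /= andbF andbT scale1r.
by rewrite place_mx1.
Qed.

Lemma sgn_idem2_sum : \sum_b sgn_idem F t 2 b = 1%:M.
Proof.
rewrite big_bool /= !sgn_idem2E -scalerDr scale1r scaleN1r addrACA addNr addr0.
by rewrite -mulr2n -scaler_nat scalerA mulVf // scale1r.
Qed.

Lemma sgn_idem2_swap : \sum_(b : bool) (-1) ^+ b *: sgn_idem F t 2 b = place_mx F t swap2.
Proof.
rewrite big_bool /= !sgn_idem2E !expr0 !expr1 !scale1r !scaleN1r -scalerN -scalerDr opprD opprK.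
rewrite addrACA addNr add0r.
by rewrite -mulr2n -scaler_nat scalerA mulVf // scale1r.
Qed.

(** The swap on V (x) V is the tensor product of the swaps of the r factors, so it acts on [eps2 f]
    by (-1)^(number of alternating factors). *)
Lemma alt2_eps : alt2 F t r = \sum_(f : I | odd (sgn_weight f)) eps2 f.
Proof.
rewrite /alt2; have -> : placeT F t (fun=> swap2) = \sum_(f : I) (-1) ^+ (sgn_weight f) *: eps2 f.
  rewrite /placeT -(eq_tens (fun k => sgn_idem2_swap)) tens_sum; apply: eq_bigr => f _.
  rewrite tens_scale; congr (_ *: _); rewrite /sgn_weight -prodr_const [RHS]big_mkcond /=.
  by apply: eq_bigr => k _; rewrite inE; case: (f k).
have e1 : 1%:M = \sum_(f : I) eps2 f.
  by rewrite -tens1 -(eq_tens (fun k => sgn_idem2_sum)) tens_sum.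
rewrite e1 -sumrB scaler_sumr [RHS]big_mkcond; apply: eq_bigr => f _.
rewrite -signr_odd; case: (odd _); last by rewrite expr0 scale1r subrr scaler0.
by rewrite expr1 scaleN1r opprK -mulr2n -scaler_nat scalerA mulVf // scale1r.
Qed.

Lemma eps2M f g : eps2 f *m eps2 g = if f == g then eps2 f else 0.
Proof.
rewrite tensM; case: eqP => [->|/eqP fg].
  by apply: eq_tens => k; rewrite sgn_idem_idem.
have /existsP[k fgk] : [exists k, f k != g k].
  rewrite -negb_forall; apply: contra fg => /forallP h.
  by apply/eqP/ffunP => k; apply/eqP.
apply/matrixP => i j; rewrite mxE [RHS]mxE (bigD1 k) //= sgn_idem_orth //.
by rewrite mxE mul0r.
Qed.

Lemma bicentr_eps2 f : bicentr (eps2 f).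
Proof. by apply: bicentr_tens => k; apply: place_span_sgn_idem. Qed.

Lemma centr_eps2 f : centr (eps2 f).
Proof.
by apply: centr_tens => k s; rewrite place_sgn_idem // sgn_idem_place.
Qed.

Lemma eps2_simple f U : centr_stable U -> (U <= eps2 f)%MS -> U != 0 -> (eps2 f <= U)%MS.
Proof.
apply: (tens_simple (chi := fun k => sgn_char F (f k))) => k.
- exact: sgn_idem_idem.
- by move=> s; exact: sgn_idem_char.
- exact: sum_sgn_char.
Qed.

Definition act2 (s : 'S_r) (f : I) : I := [ffun k => f (s^-1%g k)].

Lemma act2K s f : act2 s^-1%g (act2 s f) = f.
Proof. by apply/ffunP => k; rewrite !ffunE invgK permK. Qed.

Lemma sgn_weight_act s f : sgn_weight (act2 s f) = sgn_weight f.
Proof.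
rewrite /sgn_weight -[RHS](card_imset _ (@perm_inj _ s)); apply: eq_card => k.
rewrite -{2}(permKV s k) (mem_imset _ _ (@perm_inj _ s)) !inE ffunE //.
Qed.

Lemma eps2_act s f :
  eps2 f *m factor_mx F t 2 s = factor_mx F t 2 s *m eps2 (act2 s f).
Proof.
by rewrite factor_tens; congr (_ *m _); apply: eq_tens => k; rewrite ffunE permK.
Qed.

(** Equal numbers of [true] force equal numbers of [false], so the two tuples of values are
    rearrangements of each other. *)
Lemma sgn_weight_trans f g : sgn_weight f = sgn_weight g -> exists s, g = act2 s f.
Proof.
move=> e; pose tp (h : I) := [tuple h k | k < r].
have cnt (h : I) : count_mem true (tp h) = sgn_weight h.
  rewrite count_map /sgn_weight -sum1_count big_enum_cond -sum1_card.
  by apply: eq_bigl => k; rewrite !inE /= eqb_id.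
have : perm_eq (tp g) (tp f).
  apply/allP => b _ /=; apply/eqP.
  have cntf (h : I) : count_mem false (tp h) = (r - sgn_weight h)%N.
    rewrite -(cnt h) -[X in (X - _)%N](size_tuple (tp h)) -(count_predC (pred1 true)) addKn.
    by apply: eq_count => -[].
  by case: b; rewrite ?cnt ?cntf e.
case/tuple_permP => s es; exists s^-1%g; apply/ffunP => k; rewrite ffunE invgK.
by have /(congr1 (fun x => tnth x k)) := val_inj es; rewrite !tnth_mktuple.
Qed.

Lemma card_sgn_weight j : #|[set f : I | sgn_weight f == j]| = 'C(r, j).
Proof.
rewrite -[in RHS](card_ord r) -(card_draws 'I_r j).
rewrite -(card_imset _ (_ : injective (fun f : I => [set k | f k]))); last first.
  by move=> f g /setP h; apply/ffunP => k; have := h k; rewrite !inE.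
apply: eq_card => A; rewrite inE; apply/imsetP/idP => [[f]|cA].
  by rewrite inE => ? ->.
exists [ffun k => k \in A]; last by apply/setP => k; rewrite inE ffunE.
by rewrite inE /sgn_weight -(eqP cA); apply/eqP/eq_card => k; rewrite inE ffunE.
Qed.

Lemma rank_eps2 f : (0 < t)%N ->
  \rank (eps2 f) = ('C(t, 2) ^ sgn_weight f * 'C(t + 1, 2) ^ (r - sgn_weight f))%N.
Proof.
move=> t0; have rs : \rank (sgn_idem F t 2 false) = 'C(t + 1, 2).
  case: t t0 => // t' _.
  by rewrite rank_symmetriser // addn1.
rewrite rank_tens (bigID (fun k => f k)) /=; congr (_ * _)%N.
  rewrite (eq_bigr (fun=> 'C(t, 2))) => [|k ->]; last by rewrite rank_antisymmetriser.
  by rewrite prod_nat_const /sgn_weight; congr (_ ^ _)%N; apply: eq_card => k; rewrite !inE.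
rewrite (eq_bigr (fun=> 'C(t + 1, 2))) => [|k /negbTE ->]; last by rewrite rs.
have cC := cardsC [set k | f k]; rewrite card_ord in cC.
have -> : (r - sgn_weight f)%N = #|~: [set k | f k]| by rewrite /sgn_weight; lia.
by rewrite prod_nat_const; congr (_ ^ _)%N; apply: eq_card => k; rewrite !inE.
Qed.

Lemma sum_rank_eps2 j : (0 < t)%N -> (\sum_(f : I | sgn_weight f == j) \rank (eps2 f))%N =
  ('C(r, j) * ('C(t, 2) ^ j * 'C(t + 1, 2) ^ (r - j)))%N.
Proof.
move=> t0; rewrite -card_sgn_weight -sum_nat_const.
by apply: eq_big => [f|f /eqP fj]; rewrite ?inE ?rank_eps2 ?fj.
Qed.

Lemma orbit_sum_eps2 (Q : pred I) f : Q f -> (forall s g, Q g -> Q (act2 s g)) ->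
  (\sum_(g | sgn_weight g == sgn_weight f) \rank (eps2 g) <= \sum_(g | Q g) \rank (eps2 g))%N.
Proof.
move=> Qf Qact.
rewrite [X in (_ <= X)%N](bigID (fun g => sgn_weight g == sgn_weight f)) /=.
rewrite (eq_bigl (fun g => Q g && (sgn_weight g == sgn_weight f))) ?leq_addr // => g.
case: eqP => e; last by rewrite andbF.
have [s ->] := sgn_weight_trans (esym e); by rewrite Qact.
Qed.

End LieSquare.

Lemma leq_bin n j : (0 < j < n)%N -> (n <= 'C(n, j))%N.
Proof.
elim: n j => // n IHn [//|j] /andP[_ jn]; rewrite binS.
move: jn; rewrite ltnS leq_eqVlt => /orP[/eqP <-|jn].
  by rewrite binn binSn.
have := IHn j.+1 jn; have : (0 < 'C(n, j))%N by rewrite bin_gt0 ltnW // ltnW.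
by move: 'C(n, j) 'C(n, j.+1) => x y; lia.
Qed.

(** * Comparing the orbits in the second Lie power *)

Section PartOne.
Variables (F : finFieldType) (t r : nat).
Hypothesis F2 : (2%:R != 0 :> F)%R.
Hypothesis q2 : (2 < #|F|)%N.
Hypothesis t2 : (1 < t)%N.
Local Notation I := {ffun 'I_r -> bool}.
Local Notation P := (fun f : I => odd (sgn_weight f)).
Let t0 : (0 < t)%N := ltnW t2.

Lemma LiePow2_eps : (LiePow F t r 2 :=: (\sum_(f : I | P f) eps2 F t f)%R)%MS.
Proof. by rewrite -alt2_eps //; exact: LiePow2. Qed.

Lemma eps2_stable (f : I) (W : 'M[F]_(tdim t r 2)) : P f -> centr_stable W ->
  (W <= LiePow F t r 2)%MS -> ((W *m eps2 F t f)%R <= W)%MS.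
Proof. by move=> _ cW _; apply: cW; apply: centr_eps2. Qed.

(** The total dimension of the orbit of pieces with exactly j alternating factors. *)
Definition dim2 (j : nat) : nat := 'C(r, j) * ('C(t, 2) ^ j * 'C(t + 1, 2) ^ (r - j)).

Lemma dim2_gt0 j : j <= r -> 0 < dim2 j.
Proof. by move=> jr; rewrite !muln_gt0 bin_gt0 jr !expn_gt0 !bin_gt0 t2 addn1 ltnW. Qed.

Lemma LieSquare_min_quot j0 : odd j0 -> j0 <= r ->
  (forall j, odd j -> j <= r -> dim2 j0 <= dim2 j) -> min_quot_dim F t r 2 (dim2 j0).
Proof.
move=> oj0 j0r dmin.
apply: (min_quot_dim_sum q2 F2 (fun f g _ _ => eps2M t F2 f g) LiePow2_eps
  (fun f _ => @bicentr_eps2 F t r f) eps2_stable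
  (fun f U _ => @eps2_simple F t r F2 f U) (act := @act2 r) _ (@act2K r)
  (fun s f _ => eps2_act F t s f) (O := fun f => sgn_weight f == j0)).
- by move=> s f; rewrite sgn_weight_act.
- by move=> f /eqP ->.
- by move=> s f; rewrite sgn_weight_act.
- by rewrite sum_rank_eps2.
- exact: dim2_gt0.
- move=> Q QP Qact [f Qf _]; apply: leq_trans (orbit_sum_eps2 F t Qf Qact).
  rewrite sum_rank_eps2 //; apply: dmin; first exact: QP.
  by rewrite /sgn_weight -[X in (_ <= X)](card_ord r) max_card.
Qed.

Lemma LieSquare_reducible j0 : odd j0 -> 1 < j0 <= r ->
  min_quot_dim F t r 2 (dim2 j0) -> Hreducible F t r 2.
Proof.
move=> oj0 /andP[j1 j0r] mq.
have red := min_quot_dim_reducible (fun f g _ _ => eps2M t F2 f g) LiePow2_eps mq.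
apply: red.
rewrite (bigID (fun f : I => sgn_weight f == j0)) /=.
rewrite [X in X + _](eq_bigl (fun f : I => sgn_weight f == j0)) ?sum_rank_eps2 //; last first.
  by move=> f; case: eqP => [->|]; rewrite ?oj0 ?andbF.
rewrite -[X in X < _]addn0 ltn_add2l.
(* Weight one is odd and different from [j0], so it supplies a second non-zero orbit. *)
apply: leq_trans (_ : \sum_(f : I | sgn_weight f == 1) \rank (eps2 F t f) <= _).
  by rewrite sum_rank_eps2 // dim2_gt0 // (leq_trans _ j0r) // ltnW.
rewrite [X in _ <= X](bigID (fun f : I => sgn_weight f == 1)) /=.
rewrite [X in _ <= X + _](eq_bigl (fun f : I => sgn_weight f == 1)) ?leq_addr // => f.
have [->|] := eqVneq (sgn_weight f) 1; last by rewrite andbF.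
by rewrite andbT /= neq_ltn j1.
Qed.

(** The only odd weight up to 2 is 1, so there is a single orbit. *)
Lemma LieSquare_irreducible : r = 2 -> Hirreducible F t r 2.
Proof.
move=> r2; have w1 (f : I) : P f -> sgn_weight f = 1.
  have : sgn_weight f <= 2 by rewrite -r2 /sgn_weight -[X in (_ <= X)](card_ord r) max_card.
  by case: (sgn_weight f) => [|[|[|]]].
have PE : (fun f : I => P f) =1 (fun f => sgn_weight f == 1).
  by move=> f; apply/idP/eqP => [/w1|->].
apply: (Hirreducible_sum q2 F2 (fun f g _ _ => eps2M t F2 f g) LiePow2_eps
  (fun f _ => @bicentr_eps2 F t r f) eps2_stable
  (fun f U _ => @eps2_simple F t r F2 f U) (act := @act2 r) _
  (fun s f _ => eps2_act F t s f)).
- by move=> s f; rewrite sgn_weight_act.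
- by rewrite (eq_bigl _ _ PE) sum_rank_eps2 // dim2_gt0 // r2.
- move=> Q QP Qact [f Qf]; apply: eq_bigl => g.
  apply/idP/idP => [/QP//|Pg].
  have [s ->] := sgn_weight_trans (etrans (w1 _ (QP _ Qf)) (esym (w1 _ Pg))).
  exact: Qact.
Qed.

Lemma leq_expl x y e : x <= y -> x ^ e <= y ^ e.
Proof. by case: e => // e; rewrite leq_exp2r. Qed.

Lemma leq_bin2 : 'C(t, 2) <= 'C(t + 1, 2).
Proof. by rewrite leq_bin2l // leq_addr. Qed.

Lemma dim2_min_odd j : j <= r -> 'C(t, 2) ^ r <= dim2 j.
Proof.
move=> jr; rewrite /dim2 -[X in X <= _]mul1n leq_mul ?bin_gt0 //.
by rewrite -{1}(subnKC jr) expnD leq_mul2l leq_expl ?orbT ?leq_bin2.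
Qed.

(** At least one symmetric factor is present, the other factors are at least as large as alternating
    ones, and ['C(r, j)] is at least r for such j. *)
Lemma dim2_min_even j : 0 < j < r ->
  r * 'C(t, 2) ^ (r - 1) * 'C(t + 1, 2) <= dim2 j.
Proof.
move=> j0r; have jr : r - j = (r - 1 - j).+1 by lia.
have jr' : r - 1 = j + (r - 1 - j) by lia.
rewrite /dim2 -mulnA leq_mul ?leq_bin // jr {1}jr' expnD -mulnA leq_mul2l.
by rewrite expnSr leq_mul2r leq_expl ?leq_bin2 ?orbT.
Qed.

Lemma LieSquare : 2 < r -> Hreducible F t r 2 /\
  min_quot_dim F t r 2 (if odd r then 'C(t, 2) ^ r
                        else r * 'C(t, 2) ^ (r - 1) * 'C(t + 1, 2)).
Proof.
move=> r2; case: ifPn => [ro|re].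
  have dE : dim2 r = 'C(t, 2) ^ r by rewrite /dim2 binn subnn muln1 mul1n.
  have mq : min_quot_dim F t r 2 (dim2 r).
    by apply: LieSquare_min_quot => // j _ jr; rewrite dE dim2_min_odd.
  by split; [apply: LieSquare_reducible mq; rewrite // leqnn ltnW | rewrite -dE].
have r1 : (r - 1).+1 = r by lia.
have r1o : odd (r - 1) by move: re; rewrite -{1}r1 /= negbK.
have dE : dim2 (r - 1) = r * 'C(t, 2) ^ (r - 1) * 'C(t + 1, 2).
  rewrite /dim2 -{1}r1 binSn r1 (_ : r - (r - 1) = 1) ?expn1 ?mulnA //; lia.
have mq : min_quot_dim F t r 2 (dim2 (r - 1)).
  apply: LieSquare_min_quot => //; first lia.
  move=> j oj jr; rewrite dE dim2_min_even //; apply/andP; split; first by case: j oj jr.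
  by rewrite ltn_neqAle jr andbT; apply: contraNneq re => <-.
by split; [apply: LieSquare_reducible mq => //; lia | rewrite -dE].
Qed.

End PartOne.

(** * The group algebra of S_3 *)

Definition o0 : 'I_3 := @Ordinal 3 0 isT.
Definition o1 : 'I_3 := @Ordinal 3 1 isT.
Definition o2 : 'I_3 := @Ordinal 3 2 isT.

Lemma I3_ind (P : 'I_3 -> Prop) : P o0 -> P o1 -> P o2 -> forall i, P i.
Proof.
by move=> p0 p1 p2 -[[|[|[|//]]] i3]; [move: p0|move: p1|move: p2];
  congr (P _); apply: val_inj.
Qed.

Definition cyc3 : 'S_3 := perm (@ordS_inj 3).
Definition rev3 : 'S_3 := perm (@rev_ord_inj 3).

Lemma cyc3E : (cyc3 o0 = o1) * (cyc3 o1 = o2) * (cyc3 o2 = o0).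
Proof. by do !split; apply: val_inj; rewrite permE. Qed.

Lemma rev3E : (rev3 o0 = o2) * (rev3 o1 = o1) * (rev3 o2 = o0).
Proof. by do !split; apply: val_inj; rewrite permE. Qed.

(** Listed in the order of the coefficients of [galg], to turn sums over S_3 into six explicit
    terms. *)
Definition S3_seq : seq 'S_3 :=
  [:: 1; cyc3; cyc3 * cyc3; rev3; cyc3 * rev3; cyc3 * cyc3 * rev3]%g.

Lemma S3_seq_uniq : uniq S3_seq.
Proof.
apply: (@map_uniq _ _ (fun s : 'S_3 => (val (s o0), val (s o1)))).
by rewrite /= !permM !perm1 !(cyc3E, rev3E).
Qed.

Lemma perm_S3_seq : perm_eq (index_enum 'S_3) S3_seq.
Proof.
apply: uniq_perm; rewrite ?index_enum_uniq ?S3_seq_uniq // => s.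
rewrite mem_index_enum; apply/esym.
have : S3_seq =i 'S_3.
  apply/subset_cardP; last by apply/subsetP.
  by rewrite card_Sn (card_uniqP S3_seq_uniq).
by move=> ->.
Qed.

Lemma S3_ind (P : 'S_3 -> Prop) : P 1%g -> P cyc3 -> P (cyc3 * cyc3)%g -> P rev3 ->
  P (cyc3 * rev3)%g -> P (cyc3 * cyc3 * rev3)%g -> forall s, P s.
Proof.
move=> P0 P1 P2 P3 P4 P5 s.
have : s \in S3_seq by rewrite -(perm_mem perm_S3_seq) mem_index_enum.
by rewrite !inE => /or4P[/eqP->|/eqP->|/eqP->|/or3P[/eqP->|/eqP->|/eqP->]].
Qed.

Lemma rev3_tperm : rev3 = tperm o0 o2.
Proof.
apply/permP; elim/I3_ind; rewrite rev3E.
- by rewrite tpermL.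
- by rewrite tpermD.
- by rewrite tpermR.
Qed.

Lemma cyc3_tperm : cyc3 = (tperm o0 o1 * tperm o0 o2)%g.
Proof.
apply/permP; elim/I3_ind; rewrite cyc3E permM.
- by rewrite tpermL tpermD.
- by rewrite tpermR tpermL.
- by rewrite [tperm o0 o1 o2]tpermD // tpermR.
Qed.

Lemma odd_rev3 : odd_perm rev3 = true.
Proof. by rewrite rev3_tperm odd_tperm. Qed.

Lemma odd_cyc3 : odd_perm cyc3 = false.
Proof. by rewrite cyc3_tperm odd_mul_tperm odd_tperm. Qed.

Lemma S3_table :
  (cyc3 * (cyc3 * cyc3) = 1)%g * (cyc3 * cyc3 * cyc3 = 1)%g *
  (rev3 * rev3 = 1)%g * (rev3 * cyc3 = cyc3 * cyc3 * rev3)%g.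
Proof.
by do !split; apply/permP; elim/I3_ind; rewrite !permM ?perm1 !(cyc3E, rev3E).
Qed.

Section GroupAlgebra.
Variables (F : fieldType) (d : nat) (g1 g2 g3 g4 g5 : 'M[F]_d).
Local Open Scope ring_scope.

(* The element of the group algebra of S_3 with the given coefficients on
   1, c, c^2, s, s c, s c^2, for a 3-cycle [g1] = c and a transposition
   [g3] = s. *)
Definition galg (a0 a1 a2 a3 a4 a5 : F) : 'M[F]_d :=
  a0 *: 1%:M + a1 *: g1 + a2 *: g2 + a3 *: g3 + a4 *: g4 + a5 *: g5.

Hypotheses (h11 : g1 *m g1 = g2) (h12 : g1 *m g2 = 1%:M) (h21 : g2 *m g1 = 1%:M)
  (h33 : g3 *m g3 = 1%:M) (h31 : g3 *m g1 = g4) (h32 : g3 *m g2 = g5)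
  (h13 : g1 *m g3 = g5).

(** The hypotheses contain the presentation c^3 = s^2 = 1, c s = s c^2 of S_3, which determines all
    other products. *)
Lemma galg_table :
  (g1 *m g1 = g2) * (g1 *m g2 = 1%:M) * (g1 *m g3 = g5) * (g1 *m g4 = g3) * (g1 *m g5 = g4) *
  ((g2 *m g1 = 1%:M) * (g2 *m g2 = g1) * (g2 *m g3 = g4) * (g2 *m g4 = g5) * (g2 *m g5 = g3)) *
  ((g3 *m g1 = g4) * (g3 *m g2 = g5) * (g3 *m g3 = 1%:M) * (g3 *m g4 = g1) * (g3 *m g5 = g2)) *
  ((g4 *m g1 = g5) * (g4 *m g2 = g3) * (g4 *m g3 = g2) * (g4 *m g4 = 1%:M) * (g4 *m g5 = g1)) *
  ((g5 *m g1 = g3) * (g5 *m g2 = g4) * (g5 *m g3 = g1) * (g5 *m g4 = g2) * (g5 *m g5 = 1%:M)).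
Proof.
have h22 : g2 *m g2 = g1 by rewrite -{1}h11 -mulmxA h12 mulmx1.
have h51 : g5 *m g1 = g3 by rewrite -h32 -mulmxA h21 mulmx1.
have h52 : g5 *m g2 = g4 by rewrite -h32 -mulmxA h22.
have h41 : g4 *m g1 = g5 by rewrite -h31 -mulmxA h11.
have h42 : g4 *m g2 = g3 by rewrite -h31 -mulmxA h12 mulmx1.
have h15 : g1 *m g5 = g4 by rewrite -{1}h32 mulmxA h13.
have h23 : g2 *m g3 = g4 by rewrite -{1}h11 -mulmxA h13.
have h14 : g1 *m g4 = g3 by rewrite -h31 mulmxA h13.
have h24 : g2 *m g4 = g5 by rewrite -{1}h11 -mulmxA h14.
have h25 : g2 *m g5 = g3 by rewrite -{1}h11 -mulmxA h15.
have h34 : g3 *m g4 = g1 by rewrite -{1}h31 mulmxA h33 mul1mx.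
have h35 : g3 *m g5 = g2 by rewrite -{1}h32 mulmxA h33 mul1mx.
have h43 : g4 *m g3 = g2 by rewrite -{1}h31 -mulmxA h13.
have h44 : g4 *m g4 = 1%:M by rewrite -{1}h31 -mulmxA h14.
have h45 : g4 *m g5 = g1 by rewrite -{1}h31 -mulmxA h15.
have h53 : g5 *m g3 = g1 by rewrite -{1}h32 -mulmxA h23.
have h54 : g5 *m g4 = g2 by rewrite -{1}h32 -mulmxA h24.
have h55 : g5 *m g5 = 1%:M by rewrite -{1}h32 -mulmxA h25.
by do !split.
Qed.

(** Kept abstract because it serves twice: for one tensor factor ([s3algM]) and for the diagonal
    copy of S_3 ([lie3_idem]). *)
Lemma galgM a0 a1 a2 a3 a4 a5 b0 b1 b2 b3 b4 b5 :
  galg a0 a1 a2 a3 a4 a5 *m galg b0 b1 b2 b3 b4 b5 =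
  galg (a0 * b0 + a1 * b2 + a2 * b1 + a3 * b3 + a4 * b4 + a5 * b5)
       (a0 * b1 + a1 * b0 + a2 * b2 + a3 * b4 + a4 * b5 + a5 * b3)
       (a0 * b2 + a1 * b1 + a2 * b0 + a3 * b5 + a4 * b3 + a5 * b4)
       (a0 * b3 + a1 * b4 + a2 * b5 + a3 * b0 + a4 * b2 + a5 * b1)
       (a0 * b4 + a1 * b5 + a2 * b3 + a3 * b1 + a4 * b0 + a5 * b2)
       (a0 * b5 + a1 * b3 + a2 * b4 + a3 * b2 + a4 * b1 + a5 * b0).
Proof.
have tab := galg_table.
rewrite /galg !mulmxDl !mulmxDr -!scalemxAl -!scalemxAr !mul1mx !mulmx1 !tab.
by apply/matrixP => i j; rewrite !mxE; ring.
Qed.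

Lemma eq_galg a0 a1 a2 a3 a4 a5 b0 b1 b2 b3 b4 b5 : a0 = b0 -> a1 = b1 -> a2 = b2 ->
  a3 = b3 -> a4 = b4 -> a5 = b5 -> galg a0 a1 a2 a3 a4 a5 = galg b0 b1 b2 b3 b4 b5.
Proof. by move=> -> -> -> -> -> ->. Qed.

Lemma galgE a0 a1 a2 a3 a4 a5 i j : galg a0 a1 a2 a3 a4 a5 i j =
  a0 * (i == j)%:R + a1 * g1 i j + a2 * g2 i j + a3 * g3 i j + a4 * g4 i j + a5 * g5 i j.
Proof. by rewrite !mxE. Qed.
End GroupAlgebra.

(** * Idempotents of F[S_3] acting on third tensor powers *)

Section ThirdPower.
Variables (F : finFieldType) (t : nat).
Local Open Scope ring_scope.
Hypotheses (F2 : 2%:R != 0 :> F) (F3 : 3%:R != 0 :> F).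
Local Notation N := (pdim t 3).
Local Notation D := (tdim t 2 3).

Lemma six_neq0 : 6%:R != 0 :> F.
Proof. by rewrite (natrM F 2 3) mulf_neq0. Qed.

Lemma addmxE m n (A B : 'M[F]_(m, n)) i j : (A + B) i j = A i j + B i j.
Proof. by rewrite mxE. Qed.
Lemma oppmxE m n (A : 'M[F]_(m, n)) i j : (- A) i j = - A i j.
Proof. by rewrite mxE. Qed.
Lemma scalemxE m n a (A : 'M[F]_(m, n)) i j : (a *: A) i j = a * A i j.
Proof. by rewrite mxE. Qed.
Definition s3alg : F -> F -> F -> F -> F -> F -> 'M[F]_N :=
  galg (place_mx F t cyc3) (place_mx F t (cyc3 * cyc3)%g) (place_mx F t rev3)
    (place_mx F t (cyc3 * rev3)%g) (place_mx F t (cyc3 * cyc3 * rev3)%g).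

Lemma s3algM a0 a1 a2 a3 a4 a5 b0 b1 b2 b3 b4 b5 :
  s3alg a0 a1 a2 a3 a4 a5 *m s3alg b0 b1 b2 b3 b4 b5 =
  s3alg (a0 * b0 + a1 * b2 + a2 * b1 + a3 * b3 + a4 * b4 + a5 * b5)
       (a0 * b1 + a1 * b0 + a2 * b2 + a3 * b4 + a4 * b5 + a5 * b3)
       (a0 * b2 + a1 * b1 + a2 * b0 + a3 * b5 + a4 * b3 + a5 * b4)
       (a0 * b3 + a1 * b4 + a2 * b5 + a3 * b0 + a4 * b2 + a5 * b1)
       (a0 * b4 + a1 * b5 + a2 * b3 + a3 * b1 + a4 * b0 + a5 * b2)
       (a0 * b5 + a1 * b3 + a2 * b4 + a3 * b2 + a4 * b1 + a5 * b0).
Proof. by apply: galgM; rewrite place_mxM ?S3_table ?place_mx1. Qed.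

Lemma place_s3alg :
  (1%:M = s3alg 1 0 0 0 0 0) * (place_mx F t 1 = s3alg 1 0 0 0 0 0) *
  (place_mx F t cyc3 = s3alg 0 1 0 0 0 0) *
  (place_mx F t (cyc3 * cyc3)%g = s3alg 0 0 1 0 0 0) *
  (place_mx F t rev3 = s3alg 0 0 0 1 0 0) *
  (place_mx F t (cyc3 * rev3)%g = s3alg 0 0 0 0 1 0) *
  (place_mx F t (cyc3 * cyc3 * rev3)%g = s3alg 0 0 0 0 0 1).
Proof.
by do !split; rewrite /s3alg /galg ?place_mx1 !scale0r !scale1r ?addr0 ?add0r.
Qed.

(** The converse fails for t = 2, where the place permutations are linearly dependent; the
    identities below hold already in the group algebra, so comparing coefficients is enough. *)
Lemma eq_s3alg a0 a1 a2 a3 a4 a5 b0 b1 b2 b3 b4 b5 : a0 = b0 -> a1 = b1 -> a2 = b2 ->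
  a3 = b3 -> a4 = b4 -> a5 = b5 -> s3alg a0 a1 a2 a3 a4 a5 = s3alg b0 b1 b2 b3 b4 b5.
Proof. by move=> -> -> -> -> -> ->. Qed.

Lemma s3alg0 : s3alg 0 0 0 0 0 0 = 0.
Proof. by rewrite /s3alg /galg !scale0r !addr0. Qed.

Lemma scale_s3alg a a0 a1 a2 a3 a4 a5 : a *: s3alg a0 a1 a2 a3 a4 a5 =
  s3alg (a * a0) (a * a1) (a * a2) (a * a3) (a * a4) (a * a5).
Proof. by rewrite /s3alg /galg !scalerDr !scalerA. Qed.

Lemma add_s3alg a0 a1 a2 a3 a4 a5 b0 b1 b2 b3 b4 b5 :
  s3alg a0 a1 a2 a3 a4 a5 + s3alg b0 b1 b2 b3 b4 b5 =
  s3alg (a0 + b0) (a1 + b1) (a2 + b2) (a3 + b3) (a4 + b4) (a5 + b5).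
Proof.
rewrite /s3alg /galg; move: (place_mx F t cyc3) (place_mx F t (cyc3 * cyc3)%g)
  (place_mx F t rev3) (place_mx F t (cyc3 * rev3)%g) (place_mx F t (cyc3 * cyc3 * rev3)%g).
by move=> A1 A2 A3 A4 A5; apply/matrixP => i j; rewrite !mxE; ring.
Qed.

Lemma s3algE a0 a1 a2 a3 a4 a5 i j : s3alg a0 a1 a2 a3 a4 a5 i j =
  a0 * (i == j)%:R + a1 * place_mx F t cyc3 i j + a2 * place_mx F t (cyc3 * cyc3)%g i j
  + a3 * place_mx F t rev3 i j + a4 * place_mx F t (cyc3 * rev3)%g i j
  + a5 * place_mx F t (cyc3 * cyc3 * rev3)%g i j.
Proof. exact: galgE. Qed.

End ThirdPower.

Section ThirdPower.
Variables (F : finFieldType) (t : nat).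
Local Open Scope ring_scope.
Hypotheses (F2 : 2%:R != 0 :> F) (F3 : 3%:R != 0 :> F).
Local Notation N := (pdim t 3).
Local Notation D := (tdim t 2 3).
Let F6 := six_neq0 F2 F3.
Let n0 : (3`!)%:R != 0 :> F := F6.
Let mxlinE := (@addmxE F, @oppmxE F, @scalemxE F).
Local Notation s3alg := (@s3alg F t).
Lemma sgn_idem3E (b : bool) : let e := (-1) ^+ b / 6%:R in
  sgn_idem F t 3 b = s3alg 6%:R^-1 6%:R^-1 6%:R^-1 e e e.
Proof.
rewrite /sgn_idem (perm_big _ perm_S3_seq) /= !big_cons big_nil.
rewrite /sgn_char !odd_permM odd_perm1 odd_cyc3 odd_rev3 /= !andbF !andbT.
rewrite place_mx1 /s3alg /galg (_ : 3`! = 6%N) // addr0 !scale1r !scalerDr !scalerA.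
by rewrite !addrA ![6%:R^-1 * _]mulrC.
Qed.

(* [f3 false] and [f3 true] are primitive idempotents of the 2-dimensional
   block of F[S_3]; together with [e12] and [e21] they form matrix units of that
   block, whose identity is [q3]. *)
Definition f3 (b : bool) : 'M[F]_N := let e := (-1) ^+ b in
  s3alg 3%:R^-1 (- 6%:R^-1) (- 6%:R^-1) (e / 3%:R) (- (e / 6%:R)) (- (e / 6%:R)).
Definition e12 : 'M[F]_N := s3alg 0 2%:R^-1 (- 2%:R^-1) 0 2%:R^-1 (- 2%:R^-1).
Definition e21 : 'M[F]_N := s3alg 0 (- 6%:R^-1) 6%:R^-1 0 6%:R^-1 (- 6%:R^-1).
Definition q3 : 'M[F]_N := s3alg (2%:R / 3%:R) (- 3%:R^-1) (- 3%:R^-1) 0 0 0.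

Ltac s3field := apply: eq_s3alg; field; by rewrite ?F2 ?F3 ?F6.

Lemma place_span_s3alg a0 a1 a2 a3 a4 a5 : place_span (s3alg a0 a1 a2 a3 a4 a5).
Proof.
exists (fun s => nth 0 [:: a0; a1; a2; a3; a4; a5] (index s S3_seq)).
rewrite (perm_big _ perm_S3_seq) /= !big_cons big_nil addr0.
have nthE k : (k < 6)%N ->
    nth 0 [:: a0; a1; a2; a3; a4; a5] (index (nth 1%g S3_seq k) S3_seq) =
    nth 0 [:: a0; a1; a2; a3; a4; a5] k.
  by move=> k6; rewrite index_uniq ?S3_seq_uniq.
rewrite (nthE 0 isT) (nthE 1 isT) (nthE 2 isT) (nthE 3 isT) (nthE 4 isT) (nthE 5 isT).
by rewrite place_mx1 !addrA.
Qed.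

Lemma f3_idem b : f3 b *m f3 b = f3 b.
Proof. by case: b; rewrite /f3 s3algM ?expr0 ?expr1; s3field. Qed.

Lemma f3_orth : (f3 true *m f3 false = 0) * (f3 false *m f3 true = 0).
Proof. by split; rewrite /f3 s3algM expr0 expr1 -s3alg0; s3field. Qed.

Lemma e12_e21 : (e12 *m e21 = f3 false) * (e21 *m e12 = f3 true).
Proof. by split; rewrite /e12 /e21 /f3 s3algM ?expr0 ?expr1; s3field. Qed.

Lemma f3_e12 : (f3 false *m e12 = e12) * (e12 *m f3 false = 0) * (e12 *m f3 true = e12).
Proof. by do !split; rewrite /e12 /f3 s3algM ?expr0 ?expr1 -?s3alg0; s3field. Qed.

Lemma f3_e21 : (f3 false *m e21 = 0) * (e21 *m f3 false = e21) * (f3 true *m e21 = e21).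
Proof. by do !split; rewrite /e21 /f3 s3algM ?expr0 ?expr1 -?s3alg0; s3field. Qed.

Lemma q3_idem : q3 *m q3 = q3.
Proof. by rewrite /q3 s3algM; s3field. Qed.

Lemma q3_sgn b : (q3 *m sgn_idem F t 3 b = 0) * (sgn_idem F t 3 b *m q3 = 0).
Proof. by case: b; split; rewrite /q3 sgn_idem3E s3algM ?expr0 ?expr1 -s3alg0; s3field. Qed.

Lemma q3_central (s : 'S_3) : place_mx F t s *m q3 = q3 *m place_mx F t s.
Proof.
by elim/S3_ind: s; rewrite !place_s3alg /q3 !s3algM; apply: eq_s3alg; ring.
Qed.

Lemma sgn_f3 b b' : (sgn_idem F t 3 b *m f3 b' = 0) * (f3 b' *m sgn_idem F t 3 b = 0).
Proof.
by case: b; case: b'; split; rewrite /f3 sgn_idem3E s3algM ?expr0 ?expr1 -s3alg0; s3field.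
Qed.

Lemma one_decomp : 1%:M = sgn_idem F t 3 false + sgn_idem F t 3 true + (f3 false + f3 true).
Proof.
by rewrite !sgn_idem3E /f3 !add_s3alg place_s3alg ?expr0 ?expr1; s3field.
Qed.

(** The diagonal matrix coefficient of the 2-dimensional representation at the eigenvector of [rev3]
    with eigenvalue (-1)^b. Only 1 and [rev3] fix the middle place. *)
Definition chi3 (b : bool) (s : 'S_3) : F :=
  sgn_char F b s * (if s o1 == o1 then 1 else - 2%:R^-1).

Lemma chi3E (b : bool) : let e := (-1) ^+ b in
  (chi3 b 1%g = 1) * (chi3 b cyc3 = - 2%:R^-1) * (chi3 b (cyc3 * cyc3)%g = - 2%:R^-1) *
  (chi3 b rev3 = e) * (chi3 b (cyc3 * rev3)%g = - (e / 2%:R)) *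
  (chi3 b (cyc3 * cyc3 * rev3)%g = - (e / 2%:R)).
Proof.
have o01 : (o0 == o1) = false by []. have o21 : (o2 == o1) = false by [].
rewrite /chi3 /sgn_char; do !split.
- by rewrite odd_perm1 perm1 eqxx andbF mulr1.
- by rewrite odd_cyc3 cyc3E o21 andbF mul1r.
- by rewrite odd_permM odd_cyc3 permM !cyc3E o01 andbF mul1r.
- by rewrite odd_rev3 rev3E eqxx andbT mulr1.
- by rewrite odd_permM odd_cyc3 odd_rev3 permM cyc3E rev3E o01 andbT mulrN.
- by rewrite !odd_permM odd_cyc3 odd_rev3 !permM !cyc3E rev3E o21 andbT mulrN.
Qed.

Lemma f3_char b s : f3 b *m place_mx F t s *m f3 b = chi3 b s *: f3 b.
Proof.
elim/S3_ind: s; rewrite chi3E place_s3alg /f3 !s3algM scale_s3alg;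
  case: b; rewrite ?expr0 ?expr1; s3field.
Qed.

(** Schur orthogonality: the sum is the group order over the degree, 6/2 = 3. *)
Lemma sum_chi3 b : \sum_s chi3 b s^-1%g * chi3 b s != 0.
Proof.
suff -> : \sum_s chi3 b s^-1%g * chi3 b s = 3%:R by [].
have chiV s : chi3 b s^-1%g = chi3 b s.
  by rewrite /chi3 sgn_charV (canF_eq (permKV s)) eq_sym.
under eq_bigr => s _ do rewrite chiV.
rewrite (perm_big _ perm_S3_seq) /= !big_cons big_nil !chi3E.
by case: b {chiV}; rewrite ?expr0 ?expr1; field.
Qed.

Definition ten2 (A B : 'M[F]_N) : 'M[F]_D :=
  tens (fun k : 'I_2 => if k == ord0 then A else B).

Lemma ten2E A B i j : ten2 A B i j =
  A (slice i ord0) (slice j ord0) * B (slice i ord_max) (slice j ord_max).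
Proof.
rewrite mxE big_ord_recr big_ord1 /=.
by have -> : widen_ord (leqnSn 1) ord0 = ord0 :> 'I_2 by apply: val_inj.
Qed.

Lemma ten2M A B A' B' : ten2 A B *m ten2 A' B' = ten2 (A *m A') (B *m B').
Proof. by rewrite tensM; apply: eq_tens => k; case: ifP. Qed.

Lemma ten2_1 : ten2 1%:M 1%:M = 1%:M.
Proof. by rewrite -tens1; apply: eq_tens => k; case: ifP. Qed.

Lemma placeT2 u : placeT F t (fun _ : 'I_2 => u) = ten2 (place_mx F t u) (place_mx F t u).
Proof. by apply: eq_tens => k; case: ifP. Qed.

Lemma rank_ten2 A B : \rank (ten2 A B) = (\rank A * \rank B)%N.
Proof. by rewrite rank_tens big_ord_recr big_ord1. Qed.

(* The diagonal copy of [f3 false]; its image is the third Lie power. *)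
Definition lie3 : 'M[F]_D :=
  3%:R^-1 *: ten2 (s3alg 1 0 0 0 0 0) (s3alg 1 0 0 0 0 0) -
  6%:R^-1 *: ten2 (s3alg 0 1 0 0 0 0) (s3alg 0 1 0 0 0 0) -
  6%:R^-1 *: ten2 (s3alg 0 0 1 0 0 0) (s3alg 0 0 1 0 0 0) +
  3%:R^-1 *: ten2 (s3alg 0 0 0 1 0 0) (s3alg 0 0 0 1 0 0) -
  6%:R^-1 *: ten2 (s3alg 0 0 0 0 1 0) (s3alg 0 0 0 0 1 0) -
  6%:R^-1 *: ten2 (s3alg 0 0 0 0 0 1) (s3alg 0 0 0 0 0 1).

Local Notation PT u := (placeT F t (fun _ : 'I_2 => u)).

Lemma lie3_place : lie3 =
  3%:R^-1 *: PT 1%g - 6%:R^-1 *: PT cyc3 - 6%:R^-1 *: PT (cyc3 * cyc3)%g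
  + 3%:R^-1 *: PT rev3 - 6%:R^-1 *: PT (cyc3 * rev3)%g
  - 6%:R^-1 *: PT (cyc3 * cyc3 * rev3)%g.
Proof. by rewrite !placeT2 !place_s3alg. Qed.

Lemma lie3_mul A B : lie3 *m ten2 A B =
  3%:R^-1 *: ten2 (s3alg 1 0 0 0 0 0 *m A) (s3alg 1 0 0 0 0 0 *m B) -
  6%:R^-1 *: ten2 (s3alg 0 1 0 0 0 0 *m A) (s3alg 0 1 0 0 0 0 *m B) -
  6%:R^-1 *: ten2 (s3alg 0 0 1 0 0 0 *m A) (s3alg 0 0 1 0 0 0 *m B) +
  3%:R^-1 *: ten2 (s3alg 0 0 0 1 0 0 *m A) (s3alg 0 0 0 1 0 0 *m B) -
  6%:R^-1 *: ten2 (s3alg 0 0 0 0 1 0 *m A) (s3alg 0 0 0 0 1 0 *m B) -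
  6%:R^-1 *: ten2 (s3alg 0 0 0 0 0 1 *m A) (s3alg 0 0 0 0 0 1 *m B).
Proof.
rewrite /lie3; move: (s3alg 1 0 0 0 0 0) (s3alg 0 1 0 0 0 0) (s3alg 0 0 1 0 0 0)
  (s3alg 0 0 0 1 0 0) (s3alg 0 0 0 0 1 0) (s3alg 0 0 0 0 0 1) => X0 X1 X2 X3 X4 X5.
by rewrite !mulmxDl !mulNmx -!scalemxAl !ten2M.
Qed.

Lemma lie3_idem : lie3 *m lie3 = lie3.
Proof.
have PTM (u v : 'S_3) : PT u *m PT v = PT (v * u)%g by rewrite !placeT2 ten2M !place_mxM.
have PT1 : PT (1%g : 'S_3) = 1%:M by rewrite placeT2 place_mx1 ten2_1.
have -> : lie3 = galg (PT cyc3) (PT (cyc3 * cyc3)%g) (PT rev3) (PT (cyc3 * rev3)%g)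
    (PT (cyc3 * cyc3 * rev3)%g) 3%:R^-1 (- 6%:R^-1) (- 6%:R^-1) 3%:R^-1 (- 6%:R^-1) (- 6%:R^-1).
  by rewrite lie3_place /galg !scaleNr PT1.
rewrite galgM ?PTM ?S3_table ?PT1 //; apply: eq_galg;
  field; by rewrite ?F3 ?F6.
Qed.

Local Notation I := (option (bool * bool)).

(** Block idempotents of F[S_3] (x) F[S_3]. The four products of two one-dimensional blocks are left
    out: S_3 acts on them diagonally through a character, so [lie3] kills them. *)
Definition pi3 (o : I) : 'M[F]_D :=
  if o is Some (b, e) then if e then ten2 (sgn_idem F t 3 b) q3 else ten2 q3 (sgn_idem F t 3 b)
  else ten2 q3 q3.

Definition eps3 (o : I) : 'M[F]_D := lie3 *m pi3 o.

Ltac ten2field := apply/matrixP => i j; rewrite !mxlinE !ten2E !s3algE;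
  field; by rewrite ?F2 ?F3 ?F6.

(** Permutations act on [sgn_idem b] by scalars, so the diagonal [f3 false] becomes its twist by
    that character on the other factor, namely [f3 b]. *)
Lemma eps3_left b : eps3 (Some (b, false)) = ten2 (f3 b) (sgn_idem F t 3 b).
Proof.
by rewrite /eps3 lie3_mul /q3 /f3 sgn_idem3E !s3algM; case: b; rewrite ?expr0 ?expr1; ten2field.
Qed.

Lemma eps3_right b : eps3 (Some (b, true)) = ten2 (sgn_idem F t 3 b) (f3 b).
Proof.
by rewrite /eps3 lie3_mul /q3 /f3 sgn_idem3E !s3algM; case: b; rewrite ?expr0 ?expr1; ten2field.
Qed.

(* [eps3 None] is equivalent to the pure tensor [ten2 (f3 false) (f3 false)]
   through [ymx] and [zmx]. *)
Definition ymx : 'M[F]_D := ten2 (f3 false) (f3 false) - 3%:R *: ten2 e21 e21.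
Definition zmx : 'M[F]_D := ten2 (f3 false) (f3 false) - 3%:R^-1 *: ten2 e12 e12.

Lemma ymx_f3 : ymx *m ten2 (f3 false) (f3 false) = ymx.
Proof. by rewrite /ymx mulmxBl -scalemxAl !ten2M f3_idem f3_e21. Qed.

Lemma f3_zmx : ten2 (f3 false) (f3 false) *m zmx = zmx.
Proof. by rewrite /zmx mulmxBr -scalemxAr !ten2M f3_idem f3_e12. Qed.

Lemma ten2_0l A : ten2 0 A = 0.
Proof. by apply/matrixP => i j; rewrite ten2E !mxE mul0r. Qed.

Lemma zmx_ymx : zmx *m ymx = 2%:R *: ten2 (f3 false) (f3 false).
Proof.
rewrite /ymx /zmx !mulmxBl !mulmxBr -!scalemxAl -!scalemxAr !ten2M.
rewrite f3_idem f3_e21 f3_e12 e12_e21 !ten2_0l !scaler0 !subr0 sub0r opprK scalerA.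
by rewrite mulVf // scale1r -mulr2n scaler_nat.
Qed.

(** (21) (x) (21) contains the diagonal (21) once, so the diagonal [f3 false] has rank one there: a
    column e1 (x) e1 - 3 e2 (x) e2 times a row e1 (x) e1 - (1/3) e2 (x) e2, divided by their pairing
    2. The 3 is due to the scaling of the matrix units: inversion of permutations sends [e12] to 3
    [e21]. *)
Lemma ymx_zmx : ymx *m zmx = 2%:R *: eps3 None.
Proof.
rewrite /eps3 lie3_mul /ymx /zmx !mulmxBl !mulmxBr -!scalemxAl -!scalemxAr !ten2M.
rewrite /q3 /f3 /e12 /e21 !s3algM ?expr0; ten2field.
Qed.
End ThirdPower.

(** * The third Lie power *)

Lemma bin3_mul6 k : 6 * 'C(k, 3) = k * (k - 1) * (k - 2).
Proof. by rewrite mulnC (bin_ffact k 3) !ffactnS ffactn0 -!subn1 -!subnDA; lia. Qed.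

Lemma hook_dim t x y m : x + y + (m + m) = t ^ 3 -> 0 < t ->
  6 * x = (t + 2) * (t + 2 - 1) * (t + 2 - 2) -> 6 * y = t * (t - 1) * (t - 2) ->
  3 * m = t * (t ^ 2 - 1).
Proof.
case: t => [|[|u]] //; first by lia.
have -> : u.+2 + 2 - 1 = u + 3 by lia.
have -> : u.+2 + 2 - 2 = u + 2 by lia.
have -> : u.+2 - 1 = u + 1 by lia.
have -> : u.+2 - 2 = u by lia.
have -> : u.+2 ^ 2 - 1 = (u + 1) * (u + 3) by lia.
lia.
Qed.

(** Multiplied by m, this compares the orbit of (21) (x) (111) with the piece (21) (x) (21). *)
Lemma hook_dim_ge t c m : 1 < t -> 3 * m = t * (t ^ 2 - 1) ->
  6 * c = t * (t - 1) * (t - 2) -> 2 * c <= m.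
Proof.
case: t => [|[|u]] // _.
have -> : u.+2 - 1 = u + 1 by lia.
have -> : u.+2 - 2 = u by lia.
have -> : u.+2 ^ 2 - 1 = (u + 1) * (u + 3) by lia.
lia.
Qed.

(** The division is exact: the numerator is (3m)(6c) = 9 * 2mc. *)
Lemma quot_dimE t m c : 1 < t -> 3 * m = t * (t ^ 2 - 1) -> 6 * c = t * (t - 1) * (t - 2) ->
  (t + 1) * t ^ 2 * (t - 1) ^ 2 * (t - 2) %/ 9 = 2 * (m * c).
Proof.
move=> t2 m3 c6; suff -> : (t + 1) * t ^ 2 * (t - 1) ^ 2 * (t - 2) = 2 * (m * c) * 9.
  by rewrite mulnK.
have -> : 2 * (m * c) * 9 = (3 * m) * (6 * c) by lia.
rewrite m3 c6; move: t t2 {m3 c6} => [|[|u]] // _.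
have -> : u.+2 ^ 2 - 1 = u.+1 * u.+3 by lia.
have -> : u.+2 - 1 = u.+1 by lia.
have -> : u.+2 - 2 = u by lia.
lia.
Qed.

(** * The five pieces of the third Lie power for two tensor factors *)

Section LieCube.
Variables (F : finFieldType) (t : nat).
Local Open Scope ring_scope.
Hypotheses (F2 : 2%:R != 0 :> F) (F3 : 3%:R != 0 :> F).
Local Notation D := (tdim t 2 3).
Local Notation I := (option (bool * bool)).
Local Notation lie3 := (lie3 F t).
Local Notation eps3 := (eps3 F t).
Local Notation pi3 := (pi3 F t).
Let F6 := six_neq0 F2 F3.
Let n0 : (3`!)%:R != 0 :> F := F6.

Lemma bicentr_lie3 : bicentr lie3.
Proof.
move=> C cC; rewrite lie3_place.
have cP u : placeT F t (fun _ : 'I_2 => u) *m C = C *m placeT F t (fun _ : 'I_2 => u).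
  exact: cC.
by rewrite !mulmxDl !mulmxDr !mulNmx !mulmxN -!scalemxAl -!scalemxAr !cP.
Qed.

Lemma centr_pi3 o : centr (pi3 o).
Proof.
by case: o => [[b []]|]; apply: centr_tens => k s; case: ifP => _;
  rewrite ?q3_central // ?place_sgn_idem // sgn_idem_place.
Qed.

Lemma bicentr_pi3 o : bicentr (pi3 o).
Proof.
by case: o => [[b []]|]; apply: bicentr_tens => k; case: ifP => _;
  rewrite ?/q3; first [exact: place_span_s3alg | exact: place_span_sgn_idem].
Qed.

Lemma bicentrM a b : bicentr a -> bicentr b -> bicentr (a *m b : 'M[F]_D).
Proof. by move=> ca cb C cC; rewrite -mulmxA cb // mulmxA ca // mulmxA. Qed.

Lemma bicentr_eps3 o : bicentr (eps3 o).
Proof. exact: bicentrM bicentr_lie3 (bicentr_pi3 o). Qed.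

Lemma ten2_0r A : ten2 A 0 = 0 :> 'M[F]_D.
Proof. by apply/matrixP => i j; rewrite ten2E !mxE mulr0. Qed.

Lemma pi3M o o' : pi3 o *m pi3 o' = if o == o' then pi3 o else 0.
Proof.
have E := (ten2M, q3_idem t F3, fun b => sgn_idem_idem t n0 b, q3_sgn t F2 F3,
  sgn_idem_orth t n0 (isT : (1 < 3)%N) (isT : true != false),
  sgn_idem_orth t n0 (isT : (1 < 3)%N) (isT : false != true), ten2_0l, ten2_0r).
by case: o => [[[] []]|]; case: o' => [[[] []]|]; rewrite /pi3 /= !E.
Qed.

(** [lie3] is in the bicentraliser and [pi3 o], built from central idempotents, is in the
    centraliser, so the two commute. *)
Lemma eps3M o o' : eps3 o *m eps3 o' = if o == o' then eps3 o else 0.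
Proof.
rewrite /eps3 mulmxA -(mulmxA lie3) -(bicentr_lie3 (centr_pi3 o)) mulmxA lie3_idem //.
by rewrite -mulmxA pi3M; case: ifP; rewrite ?mulmx0.
Qed.

Lemma sum_option_bool2 (V : zmodType) (G : I -> V) : \sum_o G o =
  G None + (G (Some (false, false)) + (G (Some (false, true)) +
  (G (Some (true, false)) + G (Some (true, true))))).
Proof.
rewrite (bigD1 None) //= (bigD1 (Some (false, false))) //=.
rewrite (bigD1 (Some (false, true))) //= (bigD1 (Some (true, false))) //=.
rewrite (bigD1 (Some (true, true))) //= big_pred0 ?addr0 //.
by case=> [[[] []]|].
Qed.

Lemma lie3_eps : lie3 = \sum_o eps3 o.
Proof.
rewrite sum_option_bool2 !eps3_left // !eps3_right // /eps3 lie3_mul /lie3.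
rewrite !sgn_idem3E // /q3 /f3 !s3algM expr0 expr1.
apply/matrixP => i j; rewrite !(addmxE, oppmxE, scalemxE) !ten2E !s3algE.
by field; rewrite F3 F6.
Qed.

(** [lie3] itself is not in the centraliser, but it fixes W, so [eps3 o] acts on W as the central
    [pi3 o] does. *)
Lemma eps3_stable o (W : 'M[F]_D) : centr_stable W -> (W <= lie3)%MS ->
  (W *m eps3 o <= W)%MS.
Proof.
move=> cW /submxP[y Wy]; have -> : W *m eps3 o = W *m pi3 o.
  by rewrite Wy /eps3 !mulmxA -(mulmxA y) lie3_idem.
exact: cW (centr_pi3 o).
Qed.

Lemma eps3_simple o (U : 'M[F]_D) : centr_stable U -> (U <= eps3 o)%MS -> U != 0 ->
  (eps3 o <= U)%MS.
Proof.
case: o => [[b [] cU]|cU Ue U0].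
- rewrite eps3_right //.
  apply: (tens_simple (chi := fun k => if k == ord0 then sgn_char F b else chi3 F b)) => // k;
    case: ifP => _.
  + exact: sgn_idem_idem.
  + exact: f3_idem.
  + exact: sgn_idem_char.
  + exact: f3_char.
  + exact: sum_sgn_char.
  + exact: sum_chi3.
- rewrite eps3_left //.
  apply: (tens_simple (chi := fun k => if k == ord0 then chi3 F b else sgn_char F b)) => // k;
    case: ifP => _.
  + exact: f3_idem.
  + exact: sgn_idem_idem.
  + exact: f3_char.
  + exact: sgn_idem_char.
  + exact: sum_chi3.
  + exact: sum_sgn_char.
have UE : U *m eps3 None = U.
  by case/submxP: Ue => y ->; rewrite -mulmxA eps3M.
(* [tens_simple] needs a pure tensor: [ymx] carries U to a non-zero subspace of h, which must then
   be all of h, and [zmx] carries it back. *)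
pose h := ten2 (f3 F t false) (f3 F t false).
have cy : bicentr (ymx F t).
  apply: bicentrD; last rewrite -scaleNr; last apply: bicentrZ;
    by apply: bicentr_tens => k; case: ifP => _; exact: place_span_s3alg.
have Uyz : U *m ymx F t *m zmx F t = 2%:R *: U.
  by rewrite -mulmxA ymx_zmx // -scalemxAr UE.
have hU : (h <= U *m ymx F t)%MS.
  apply: (tens_simple (chi := fun k => chi3 F false)); last 3 first.
  - exact: centr_stableM.
  - by rewrite -(ymx_f3 t F2 F3) mulmxA submxMl.
  - apply: contraNneq U0 => e; move: Uyz; rewrite e mul0mx => /esym/eqP.
    by rewrite scaler_eq0 (negbTE F2).
  - by move=> k; case: ifP => _; exact: f3_idem.
  - by move=> k s; case: ifP => _; exact: f3_char.
  - by move=> k; exact: sum_chi3.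
have : (h *m zmx F t <= U)%MS.
  apply: submx_trans (submxMr _ hU) _; rewrite Uyz; exact: scalemx_sub.
apply: submx_trans; rewrite -(eqmx_scale _ F2) -ymx_zmx // -{1}(f3_zmx t F2 F3).
exact: submxMl.
Qed.

Definition act3 (s : 'S_2) (o : I) : I :=
  if s ord0 == ord0 then o else if o is Some (b, e) then Some (b, ~~ e) else None.

Lemma S2_cases (s : 'S_2) : s = 1%g \/ s = swap2.
Proof.
have [e|e] := eqVneq (s ord0) ord0; [left|right]; apply/permP => k.
  rewrite perm1; have [->|k0] := eqVneq k ord0; first by [].
  have -> : k = ord_max by apply: val_inj; case: k k0 => -[|[|]].
  apply/eqP; have : s ord_max != ord0 by rewrite -[X in _ != X]e (inj_eq perm_inj).
  by case: (s ord_max) => -[|[|]].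
have s0 : s ord0 = ord_max by apply: val_inj; move: e; case: (s ord0) => -[|[|]].
have [->|k0] := eqVneq k ord0; first by rewrite tpermL.
have -> : k = ord_max by apply: val_inj; case: k k0 => -[|[|]].
rewrite tpermR; apply: val_inj.
have : s ord_max != ord_max by rewrite -[X in _ != X]s0 (inj_eq perm_inj).
by case: (s ord_max) => -[|[|]].
Qed.

Lemma act3K s o : act3 s^-1%g (act3 s o) = o.
Proof.
rewrite /act3; case: (S2_cases s) => ->; first by rewrite invg1 perm1.
by rewrite tpermV tpermL /=; case: o => [[b e]|] //=; rewrite negbK.
Qed.

Lemma eps3_act s o :
  eps3 o *m factor_mx F t 3 s = factor_mx F t 3 s *m eps3 (act3 s o).
Proof.
have PTf u : factor_mx F t 3 s *m placeT F t (fun _ : 'I_2 => u) =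
             placeT F t (fun _ : 'I_2 => u) *m factor_mx F t 3 s.
  by rewrite factor_tens.
have -> : factor_mx F t 3 s *m eps3 (act3 s o) = lie3 *m (factor_mx F t 3 s *m pi3 (act3 s o)).
  rewrite /eps3 !mulmxA; congr (_ *m _); rewrite lie3_place.
  by rewrite !mulmxDl !mulmxDr !mulNmx !mulmxN -!scalemxAl -!scalemxAr !PTf.
rewrite -mulmxA; congr (_ *m _); rewrite /act3.
case: (S2_cases s) => -> {PTf}; first by rewrite perm1 factor_mx1 mulmx1 mul1mx.
have sw (k : 'I_2) : (swap2 k == ord0) = (k != ord0).
  have [->|k0] := eqVneq k ord0; first by rewrite tpermL.
  by have -> : k = ord_max; [apply: val_inj; case: k k0 => -[|[|]] | rewrite tpermR].
rewrite tpermL /=; case: o => [[b []]|] /=; rewrite factor_tens; congr (_ *m _);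
  by apply: eq_tens => k; rewrite sw; case: eqP.
Qed.

(** Diagonal matrix units of one block factor through each other by means of [e12] and [e21]. *)
Lemma rank_f3_eq : \rank (f3 F t true) = \rank (f3 F t false).
Proof.
apply/eqP; rewrite eqn_leq; apply/andP; split.
  rewrite -(e12_e21 t F2 F3).2 -{1}(f3_e12 t F2 F3).1.1 mulmxA.
  by apply: leq_trans (mxrankM_maxl _ _) (mxrankM_maxr _ _).
rewrite -(e12_e21 t F2 F3).1 -{1}(f3_e21 t F2 F3).2 mulmxA.
by apply: leq_trans (mxrankM_maxl _ _) (mxrankM_maxr _ _).
Qed.

Lemma rank_sgn3 b : (0 < t)%N ->
  \rank (sgn_idem F t 3 b) = if b then 'C(t, 3) else 'C(t + 2, 3).
Proof.
move=> t0; case: b; first by rewrite rank_antisymmetriser.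
by case: t t0 => // t' _; rewrite rank_symmetriser //; congr 'C(_, _); lia.
Qed.

(** Comparing ranks in [one_decomp]: t^3 is the symmetric cube plus the exterior cube plus two
    copies of the hook. *)
Lemma rank_f3 b : (0 < t)%N -> (3 * \rank (f3 F t b) = t * (t ^ 2 - 1))%N.
Proof.
move=> t0; have -> : \rank (f3 F t b) = \rank (f3 F t false).
  by case: b; rewrite ?rank_f3_eq.
have e : \rank (1%:M : 'M[F]_(pdim t 3)) = (t ^ 3)%N.
  by rewrite mxrank1 /pdim card_tuple card_ord.
rewrite (one_decomp t F2 F3) in e.
have so := sgn_idem_orth t n0 (isT : (1 < 3)%N).
have si b' := sgn_idem_idem t n0 b'.
have fi b' := f3_idem t F2 F3 b'.
have fo := f3_orth t F2 F3.
have sf b' b'' := sgn_f3 t F2 F3 b' b''.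
rewrite rank_add_orth in e; last 4 first.
- by apply: add_idem; rewrite ?si ?so.
- by apply: add_idem; rewrite ?fi ?fo.
- by apply: add_orth; rewrite sf.
- by apply: add_orth; rewrite sf.
rewrite (rank_add_orth (si false) (si true) (so false true isT) (so true false isT)) in e.
rewrite (rank_add_orth (fi false) (fi true) fo.2 fo.1) in e.
rewrite rank_f3_eq (rank_sgn3 true) // in e.
rewrite rank_sgn3 // in e; exact: hook_dim e t0 (bin3_mul6 _) (bin3_mul6 _).
Qed.

Definition T2 (a b : Idx t 2) : Tidx t 2 2 := [ffun i : 'I_2 => if i == ord0 then a else b].
Definition T3 (a b c : Idx t 2) : Tidx t 2 3 :=
  [ffun i : 'I_3 => if i == o0 then a else if i == o1 then b else c].

Lemma T3_eta (c : Tidx t 2 3) : T3 (c o0) (c o1) (c o2) = c.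
Proof. by apply/ffunP; elim/I3_ind; rewrite ffunE. Qed.

Lemma T3E a b c : (T3 a b c o0 = a) * (T3 a b c o1 = b) * (T3 a b c o2 = c).
Proof. by rewrite !ffunE. Qed.

Lemma cyc3V : (cyc3^-1%g o0 = o2) * (cyc3^-1%g o1 = o0) * (cyc3^-1%g o2 = o1).
Proof. by do !split; apply: (@perm_inj _ cyc3); rewrite permKV cyc3E. Qed.

Lemma rev3V : (rev3^-1%g o0 = o2) * (rev3^-1%g o1 = o1) * (rev3^-1%g o2 = o0).
Proof. by do !split; apply: (@perm_inj _ rev3); rewrite permKV rev3E. Qed.

Lemma tcoord_lie3 x a b c : tcoord F t 2 3 (x *m lie3) (T3 a b c) =
  3%:R^-1 * tcoord F t 2 3 x (T3 a b c) - 6%:R^-1 * tcoord F t 2 3 x (T3 c a b)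
  - 6%:R^-1 * tcoord F t 2 3 x (T3 b c a) + 3%:R^-1 * tcoord F t 2 3 x (T3 c b a)
  - 6%:R^-1 * tcoord F t 2 3 x (T3 b a c) - 6%:R^-1 * tcoord F t 2 3 x (T3 a c b).
Proof.
rewrite lie3_place !mulmxDr !mulmxN -!scalemxAr !(tcoordD, tcoordN, tcoordZ) !tcoord_place.
have T3P (u : 'S_3) a' b' c' : T3 a b c (u^-1%g o0) = a' -> T3 a b c (u^-1%g o1) = b' ->
    T3 a b c (u^-1%g o2) = c' -> [ffun m => T3 a b c (u^-1%g m)] = T3 a' b' c'.
  by move=> <- <- <-; apply/ffunP; elim/I3_ind; rewrite !ffunE.
have e2 : [ffun m => T3 a b c ((cyc3 * cyc3)^-1%g m)] = T3 b c a.
  by apply: T3P; rewrite invMg permM !cyc3V T3E.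
have e4 : [ffun m => T3 a b c ((cyc3 * rev3)^-1%g m)] = T3 b a c.
  by apply: T3P; rewrite invMg permM !(rev3V, cyc3V) T3E.
have e5 : [ffun m => T3 a b c ((cyc3 * cyc3 * rev3)^-1%g m)] = T3 a c b.
  by apply: T3P; rewrite !invMg !permM !(rev3V, cyc3V) T3E.
rewrite e2 e4 e5 (T3P 1%g a b c) ?invg1 ?perm1 ?T3E //.
by rewrite (T3P cyc3 c a b) ?cyc3V ?T3E // (T3P rev3 c b a) ?rev3V ?T3E.
Qed.

Lemma tcoord_lbr2 x v a b c : tcoord F t 2 3 (lbr F t 2 2 x v) (T3 a b c) =
  tcoord F t 2 2 x (T2 a b) * tcoord F t 2 1 v [ffun=> c] -
  tcoord F t 2 1 v [ffun=> a] * tcoord F t 2 2 x (T2 b c).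
Proof.
rewrite tcoord_lbr.
have -> : [ffun i : 'I_2 => T3 a b c (widen_ord (leqnSn 2) i)] = T2 a b.
  by apply/ffunP => -[[|[|//]] ilt]; rewrite !ffunE.
have -> : [ffun i : 'I_2 => T3 a b c (lift ord0 i)] = T2 b c.
  by apply/ffunP => -[[|[|//]] ilt]; rewrite !ffunE.
by rewrite !ffunE.
Qed.

Lemma tcoord_lbr1_T2 x v a b : tcoord F t 2 2 (lbr F t 2 1 x v) (T2 a b) =
  tcoord F t 2 1 x [ffun=> a] * tcoord F t 2 1 v [ffun=> b] -
  tcoord F t 2 1 v [ffun=> a] * tcoord F t 2 1 x [ffun=> b].
Proof. by rewrite tcoord_lbr1 !ffunE. Qed.

Lemma LiePow2_antisym x a b : (x <= LiePow F t 2 2)%MS ->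
  tcoord F t 2 2 x (T2 b a) = - tcoord F t 2 2 x (T2 a b).
Proof.
rewrite LiePow2 // => /submxP[y ->].
rewrite -scalemxAr mulmxBr mulmx1 !(tcoordZ, tcoordD, tcoordN) !tcoord_swap2.
have sw c d : [ffun m => T2 c d (swap2 m)] = T2 d c.
  by apply/ffunP => -[[|[|//]] ilt]; rewrite !ffunE;
     [rewrite (_ : Ordinal ilt = ord0) ?tpermL | rewrite (_ : Ordinal ilt = ord_max) ?tpermR] => //;
     apply: val_inj.
by rewrite !sw; ring.
Qed.

(** Triple brackets are fixed by reversal of the places and killed by the sum over cyclic shifts
    (Jacobi); these two conditions cut out the image of [lie3]. Conversely, [lie3] maps a (x) b (x)
    c to ([[a,b],c] + [[c,b],a])/6. *)
Lemma LiePow3 : (LiePow F t 2 3 :=: lie3)%MS.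
Proof.
apply/eqmxP/andP; split.
  apply: LiePow_sub => x v xL.
  suff <- : lbr F t 2 2 x v *m lie3 = lbr F t 2 2 x v by apply: submxMl.
  apply: tcoord_inj => d; rewrite -(T3_eta d) tcoord_lie3 !tcoord_lbr2.
  rewrite (LiePow2_antisym (d o0) (d o1)) // (LiePow2_antisym (d o1) (d o2)) //.
  rewrite (LiePow2_antisym (d o0) (d o2)) //.
  by field; rewrite F3 F6.
apply/row_subP => i; rewrite rowE.
pose e k := tvec1 F (Defs.tval t 2 3 i k).
have -> : delta_mx 0 i *m lie3 = 6%:R^-1 *:
    (lbr F t 2 2 (lbr F t 2 1 (e o0) (e o1)) (e o2) +
     lbr F t 2 2 (lbr F t 2 1 (e o2) (e o1)) (e o0)).
  apply: tcoord_inj => d; rewrite -(T3_eta d) tcoord_lie3 tcoordZ tcoordD !tcoord_lbr2.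
  rewrite !tcoord_lbr1_T2 !tcoord_tvec1 !tcoord_delta.
  have eqT x y z : (T3 x y z == Defs.tval t 2 3 i)%:R = (x == Defs.tval t 2 3 i o0)%:R *
      (y == Defs.tval t 2 3 i o1)%:R * (z == Defs.tval t 2 3 i o2)%:R :> F.
    rewrite -!natrM !mulnb; congr (nat_of_bool _)%:R; apply/eqP/idP => [<-|].
      by rewrite !T3E !eqxx.
    by move=> /andP[/andP[/eqP-> /eqP->] /eqP->]; rewrite T3_eta.
  rewrite !eqT; field.
  by rewrite F3 F6.
by rewrite scalemx_sub // addmx_sub // !lbr_LiePow // submx1.
Qed.

Lemma rank_eps3_pair b e : (0 < t)%N -> \rank (eps3 (Some (b, e))) =
  (\rank (f3 F t false) * if b then 'C(t, 3) else 'C(t + 2, 3))%N.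
Proof.
move=> t0; have rf : \rank (f3 F t b) = \rank (f3 F t false) by case: b; rewrite ?rank_f3_eq.
case: e; first by rewrite eps3_right // rank_ten2 rank_sgn3 // rf mulnC.
by rewrite eps3_left // rank_ten2 rank_sgn3 // rf.
Qed.

Lemma rank_eps3_None : \rank (eps3 None) = (\rank (f3 F t false) * \rank (f3 F t false))%N.
Proof.
rewrite -rank_ten2; apply/eqP; rewrite eqn_leq; apply/andP; split.
  rewrite -(mxrank_scale_nz _ F2) -ymx_zmx // -(ymx_f3 t F2 F3).
  exact: leq_trans (mxrankM_maxl _ _) (mxrankM_maxr _ _).
rewrite -(mxrank_scale_nz _ F2) -zmx_ymx // -[X in (_ <= X)%N](mxrank_scale_nz _ F2).
rewrite -ymx_zmx // -(mxrank_scale_nz (zmx F t *m ymx F t) F2).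
(* [zmx *m ymx] is twice an idempotent, so its square is twice itself; this exhibits it as a
   multiple of [ymx *m zmx]. *)
have -> : 2%:R *: (zmx F t *m ymx F t) = zmx F t *m (ymx F t *m zmx F t) *m ymx F t.
  rewrite !mulmxA -mulmxA zmx_ymx // -scalemxAl -scalemxAr ten2M f3_idem //.
exact: leq_trans (mxrankM_maxl _ _) (mxrankM_maxr _ _).
Qed.

End LieCube.

(** * Comparing the orbits in the third Lie power *)

Section PartTwo.
Variables (F : finFieldType) (t : nat).
Hypotheses (F2 : (2%:R != 0 :> F)%R) (F3 : (3%:R != 0 :> F)%R) (q_gt3 : 3 < #|F|) (t2 : 1 < t).
Local Notation I := (option (bool * bool)).
Let n0 : ((3`!)%:R != 0 :> F)%R := six_neq0 F2 F3.

Lemma LiePow3_eps : (LiePow F t 2 3 :=: (\sum_(o : I | true) eps3 F t o)%R)%MS.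
Proof. by rewrite -lie3_eps //; exact: LiePow3. Qed.

Lemma LieCube_stable (o : I) (W : 'M[F]_(tdim t 2 3)) : true -> centr_stable W ->
  (W <= LiePow F t 2 3)%MS -> ((W *m eps3 F t o)%R <= W)%MS.
Proof. by move=> _ cW WL; apply: eps3_stable => //; rewrite -(LiePow3 t F2 F3). Qed.

Lemma sum_eps3 (Q : pred I) : (\sum_(o | Q o) \rank (eps3 F t o) =
  (if Q None then \rank (eps3 F t None) else 0) +
  ((if Q (Some (false, false)) then \rank (eps3 F t (Some (false, false))) else 0) +
  ((if Q (Some (false, true)) then \rank (eps3 F t (Some (false, true))) else 0) +
  ((if Q (Some (true, false)) then \rank (eps3 F t (Some (true, false))) else 0) +
   (if Q (Some (true, true)) then \rank (eps3 F t (Some (true, true))) else 0)))))%N.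
Proof.
rewrite big_mkcond /= (bigD1 None) //= (bigD1 (Some (false, false))) //=.
rewrite (bigD1 (Some (false, true))) //= (bigD1 (Some (true, false))) //=.
rewrite (bigD1 (Some (true, true))) //= big_pred0 ?addn0 //.
by case=> [[[] []]|].
Qed.

Lemma act3_closed (Q : pred I) : (forall s o, Q o -> Q (act3 s o)) ->
  forall b e, Q (Some (b, e)) = Q (Some (b, false)).
Proof.
move=> Qact b [] //; have sw : swap2 ord0 == ord0 = false by rewrite tpermL.
by apply/idP/idP => /(Qact swap2); rewrite /act3 sw.
Qed.

Lemma LieCube : Hreducible F t 2 3 /\
  min_quot_dim F t 2 3 (if t == 2 then 4
    else (t + 1) * t ^ 2 * (t - 1) ^ 2 * (t - 2) %/ 9).
Proof.
have t0 : 0 < t by apply: ltnW.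
pose m := \rank (f3 F t false).
have m3 : 3 * m = t * (t ^ 2 - 1) by apply: rank_f3.
have m0 : 0 < m.
  have : 0 < 3 * m by rewrite m3 muln_gt0 t0 subn_gt0 -{1}(exp1n 2) ltn_exp2r.
  by rewrite muln_gt0.
have rN : \rank (eps3 F t None) = m * m by apply: rank_eps3_None.
have rS b e : \rank (eps3 F t (Some (b, e))) = m * (if b then 'C(t, 3) else 'C(t + 2, 3)).
  exact: rank_eps3_pair.
have c20 : 0 < 'C(t + 2, 3) by rewrite bin_gt0; lia.
(* The missing orbit is that of (21) (x) (111). For t = 2 it is zero, and (21) (x) (21), of
   dimension 2 * 2, replaces it. *)
pose O : pred I := if t == 2 then (fun o => o == None) else
  (fun o => if o is Some (b, _) then b else false).
pose d := if t == 2 then 4 else 2 * (m * 'C(t, 3)).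
have dE : d = if t == 2 then 4 else (t + 1) * t ^ 2 * (t - 1) ^ 2 * (t - 2) %/ 9.
  by rewrite /d; case: eqP => // _; rewrite (quot_dimE t2 m3 (bin3_mul6 t)).
have m2 : t = 2 -> m = 2 by move=> e; move: m3; rewrite e; lia.
have mC : m * (2 * 'C(t, 3)) <= m * m.
  by rewrite leq_mul2l (hook_dim_ge t2 m3 (bin3_mul6 t)) orbT.
have CC : m * 'C(t, 3) <= m * 'C(t + 2, 3) by rewrite leq_mul2l leq_bin2l ?orbT // leq_addr.
have c30 : t != 2 -> 0 < 'C(t, 3) by rewrite bin_gt0; lia.
have dsum : d = \sum_(o : I | O o) \rank (eps3 F t o).
  rewrite sum_eps3 !rS rN /d /O; case: (eqVneq t 2) => [e|_] /=; last by lia.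
  by rewrite m2.
have mq : min_quot_dim F t 2 3 d.
  have mqs := @min_quot_dim_sum F t 2 3 I xpredT (eps3 F t) act3 q_gt3 n0
    (fun o o' _ _ => eps3M t F2 F3 o o') LiePow3_eps (fun o _ => @bicentr_eps3 F t o)
    LieCube_stable (fun o U _ => @eps3_simple F t F2 F3 o U) (fun _ _ _ => isT) act3K
    (fun s o _ => @eps3_act F t s o) O d (fun _ _ => isT).
  apply: mqs => //.
  - by move=> s o; rewrite /O /act3; case: ifP => _; case: ifP => _ //; case: o => [[]|].
  - rewrite /d; case: eqP => // /eqP t22; rewrite !muln_gt0 m0 c30 //.
  move=> Q _ Qact [o Qo ro]; rewrite sum_eps3 !rS rN.
  rewrite !(act3_closed Qact _ true); rewrite /d; case: (eqVneq t 2) => [e|t22].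
    have -> := m2 e; have : 'C(t, 3) = 0 by rewrite e.
    case: o Qo ro => [[b e'] Qo ro|->]; last by lia.
    move: Qo; rewrite (act3_closed Qact); move: ro; rewrite rS.
    have -> : 'C(t + 2, 3) = 4 by rewrite e.
    by case: b => [|_ -> _]; [move=> + _ C0; rewrite C0 muln0 | lia].
  case: o Qo ro => [[b e'] Qo _|-> _]; last by apply: leq_trans (leq_addr _ _); lia.
  move: Qo; rewrite (act3_closed Qact); case: b => ->; last first.
    by apply: leq_trans (leq_addl _ _); lia.
  by apply: leq_trans (leq_addl _ _); apply: leq_trans (leq_addl _ _); lia.
rewrite -dE; split=> //.
apply: (min_quot_dim_reducible (fun o o' _ _ => eps3M t F2 F3 o o') LiePow3_eps mq).
rewrite sum_eps3 !rS rN /d /=; case: (eqVneq t 2) => [e|_]; first by rewrite m2 // e.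
have mm : 0 < m * m by rewrite muln_gt0 m0.
lia.
Qed.
End PartTwo.

Theorem mainTheorem14 (F : finFieldType) (p t r : nat) :
  (p \in [pchar F])%R -> (2 < p)%N -> (2 <= r)%N -> (2 <= t)%N ->
  ((2 < r)%N ->
     Hreducible F t r 2 /\
     min_quot_dim F t r 2
       (if odd r then ('C(t, 2) ^ r)%N
        else (r * 'C(t, 2) ^ (r - 1) * 'C(t + 1, 2))%N)) /\
  ((3 < p)%N -> r = 2%N ->
     Hirreducible F t r 2 /\ Hreducible F t r 3 /\
     min_quot_dim F t r 3
       (if t == 2%N then 4%N
        else ((t + 1) * t ^ 2 * (t - 1) ^ 2 * (t - 2) %/ 9)%N)).
Proof.
move=> pF p2 r2 t2.
have small k : 0 < k < p -> (k%:R != 0 :> F)%R.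
  by case/andP=> k0 kp; rewrite -(dvdn_pcharf pF) gtnNdvd.
(* Together with n < p this gives n < |F|, as required by the density argument. *)
have pq : p <= #|F|.
  by apply: dvdn_leq; rewrite ?(ltnW (finNzRing_gt1 F)) // (dvdn_pcharf pF) natr_card_finField.
have F2 : (2%:R != 0 :> F)%R by apply: small.
split=> [r3|p3 ->].
  by apply: LieSquare => //; apply: leq_trans pq.
have F3 : (3%:R != 0 :> F)%R by apply: small.
split; first by apply: LieSquare_irreducible => //; apply: leq_trans pq.
by apply: LieCube => //; apply: leq_trans pq.
Qed.
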